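(* Let $\alpha\in\mathbb{Q}$ with $\alpha>0$. As $A$ ranges over totally definite quaternion algebras over $\mathbb{Q}$ and $\Lambda$ over $\mathbb{Z}$-orders of $A$, there are, up to scaling, exactly three well-rounded lattices of the form $(\Lambda,b_\alpha)$, namely $\mathbb{Z}^4$, $D_4$ and $A_2\oplus A_2$. That is, if $(\Lambda,b_\alpha)$ is well-rounded then it is similar to one of $\mathbb{Z}^4$, $D_4$, $A_2\oplus A_2$, and each of these three lattices occurs up to similarity.
   Context: A quaternion algebra over $\mathbb{Q}$ is $A=\left(\frac{a,b}{\mathbb{Q}}\right)=\mathbb{Q}\oplus\mathbb{Q}i\oplus\mathbb{Q}j\oplus\mathbb{Q}ij$ with $i^2=a$, $j^2=b$, $ij=-ji$, $a,b\in\mathbb{Q}^\times$. It is totally definite if $A\otimes_{\mathbb{Q}}\mathbb{R}\cong\mathbb{H}$ (the Hamilton quaternions). For $x=x_0+x_1i+x_2j+x_3ij$, put $\overline{x}=x_0-x_1i-x_2j-x_3ij$ and $tr_{A/\mathbb{Q}}(x)=x+\overline{x}$. A $\mathbb{Z}$-order $\Lambda$ of $A$ is a subring containing $1$ that is a finitely generated $\mathbb{Z}$-module containing a $\mathbb{Q}$-basis of $A$. The lattice $(\Lambda,b_\alpha)$ is the free $\mathbb{Z}$-module $\Lambda$ of rank $4$ together with the positive definite symmetric bilinear form on $A\otimes_{\mathbb{Q}}\mathbb{R}$ which extends $\mathbb{R}$-bilinearly $b_\alpha(x,y)=tr_{A/\mathbb{Q}}(\alpha x\overline{y})$, $x,y\in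 A$. A lattice is well-rounded if its minimum vectors (nonzero vectors $x$ minimizing $b_\alpha(x,x)$) span the ambient real vector space $\Lambda\otimes_{\mathbb{Z}}\mathbb{R}$. Two lattices with Gram matrices $G_1,G_2$ are similar (equal up to scaling) if $G_1=rUG_2U^T$ for some real $r>0$ and some unimodular integer matrix $U$. $D_4=\{x\in\mathbb{Z}^4 : x_1+x_2+x_3+x_4 \text{ even}\}$, and $A_2$ is the hexagonal lattice, with Gram matrix $\begin{pmatrix}2&-1\\-1&2\end{pmatrix}$; $\oplus$ denotes orthogonal direct sum. *)

(* Defs.v *)
From HB Require Import structures.
From mathcomp Require Import all_boot all_order all_algebra ring.
From mathcomp Require Import reals.

Set Implicit Arguments.
Unset Strict Implicit.
Unset Printing Implicit Defensive.

Import Order.TTheory GRing.Theory Num.Theory.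
Local Open Scope ring_scope.

(* The quaternion algebra (a, b / F), carried by coordinate row vectors in the
   basis 1, i, j, ij. It is only used for a and b nonzero, but the ring axioms
   do not need this. *)
Definition quat (F : fieldType) (a b : F) : Type := 'rV[F]_4.

HB.instance Definition _ (F : fieldType) (a b : F) :=
  Vector.copy (quat a b) 'rV[F]_4.

Section QuaternionAlgebra.
Variables (F : fieldType) (a b : F).
Local Notation A := (quat a b).
Implicit Types x y z : A.

Definition mkquat (x0 x1 x2 x3 : F) : A :=
  \row_(k < 4) nth 0 [:: x0; x1; x2; x3] k.

Definition qcoef x (k : 'I_4) : F := x 0 k.

Definition qone : A := mkquat 1 0 0 0.

(* Expansion of (x0 + x1 i + x2 j + x3 ij) (y0 + y1 i + y2 j + y3 ij) with
   i^2 = a, j^2 = b, ij = - ji, so that (ij)^2 = - a b. *)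
Definition qmul x y : A :=
  let x0 := qcoef x 0 in let x1 := qcoef x 1 in
  let x2 := qcoef x 2 in let x3 := qcoef x 3 in
  let y0 := qcoef y 0 in let y1 := qcoef y 1 in
  let y2 := qcoef y 2 in let y3 := qcoef y 3 in
  mkquat (x0 * y0 + a * (x1 * y1) + b * (x2 * y2) - a * b * (x3 * y3))
         (x0 * y1 + x1 * y0 - b * (x2 * y3) + b * (x3 * y2))
         (x0 * y2 + x2 * y0 + a * (x1 * y3) - a * (x3 * y1))
         (x0 * y3 + x3 * y0 + x1 * y2 - x2 * y1).

Lemma qcoef_mk (x0 x1 x2 x3 : F) (k : 'I_4) :
  qcoef (mkquat x0 x1 x2 x3) k = nth 0 [:: x0; x1; x2; x3] k.
Proof. by rewrite /qcoef mxE. Qed.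

Lemma qcoefD x y k : qcoef (x + y) k = qcoef x k + qcoef y k.
Proof. by rewrite /qcoef mxE. Qed.

Lemma qcoefN x k : qcoef (- x) k = - qcoef x k.
Proof. by rewrite /qcoef mxE. Qed.

Lemma qcoefZ c x k : qcoef (c *: x) k = c * qcoef x k.
Proof. by rewrite /qcoef mxE. Qed.

Lemma quatP x y :
  qcoef x 0 = qcoef y 0 -> qcoef x 1 = qcoef y 1 ->
  qcoef x 2 = qcoef y 2 -> qcoef x 3 = qcoef y 3 -> x = y.
Proof.
move=> h0 h1 h2 h3; apply/rowP => -[[|[|[|[|//]]]] lt_k4].
- by move: h0; rewrite /qcoef; congr (x 0 _ = y 0 _); apply: val_inj.
- by move: h1; rewrite /qcoef; congr (x 0 _ = y 0 _); apply: val_inj.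
- by move: h2; rewrite /qcoef; congr (x 0 _ = y 0 _); apply: val_inj.
- by move: h3; rewrite /qcoef; congr (x 0 _ = y 0 _); apply: val_inj.
Qed.

Local Ltac qring :=
  apply: quatP; rewrite /qmul /qone ?(qcoef_mk, qcoefD, qcoefN, qcoefZ) /=; ring.

Fact qmulA : associative qmul. Proof. by move=> x y z; qring. Qed.
Fact qmul1x : left_id qone qmul. Proof. by move=> x; qring. Qed.
Fact qmulx1 : right_id qone qmul. Proof. by move=> x; qring. Qed.
Fact qmulDl : left_distributive qmul +%R. Proof. by move=> x y z; qring. Qed.
Fact qmulDr : right_distributive qmul +%R. Proof. by move=> x y z; qring. Qed.

Fact qone_neq0 : qone != 0.
Proof.
apply/eqP => /(congr1 (fun x : A => qcoef x 0)).
by rewrite qcoef_mk /qcoef mxE => /eqP; rewrite oner_eq0.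
Qed.

HB.instance Definition _ := GRing.Zmodule_isNzRing.Build A
  qmulA qmul1x qmulx1 qmulDl qmulDr qone_neq0.

Lemma qmulE x y : x * y = qmul x y. Proof. by []. Qed.
Lemma qoneE : 1 = qone. Proof. by []. Qed.

Local Ltac qringE := rewrite ?qmulE ?qoneE; qring.

Fact qscalerAl (c : F) x y : c *: (x * y) = (c *: x) * y.
Proof. by qringE. Qed.

HB.instance Definition _ := GRing.Lmodule_isLalgebra.Build F A qscalerAl.

Fact qscalerAr (c : F) x y : c *: (x * y) = x * (c *: y).
Proof. by qringE. Qed.

HB.instance Definition _ := GRing.Lalgebra_isAlgebra.Build F A qscalerAr.

Definition qi : A := mkquat 0 1 0 0.
Definition qj : A := mkquat 0 0 1 0.

Lemma qi_sqr : qi * qi = a%:A. Proof. by rewrite /qi /qj; qringE. Qed.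
Lemma qj_sqr : qj * qj = b%:A. Proof. by rewrite /qi /qj; qringE. Qed.
Lemma qij_anticomm : qi * qj = - (qj * qi). Proof. by rewrite /qi /qj; qringE. Qed.

Lemma quat_expand x :
  x = qcoef x 0 *: 1 + qcoef x 1 *: qi + qcoef x 2 *: qj
      + qcoef x 3 *: (qi * qj).
Proof. by rewrite /qi /qj; qringE. Qed.

Definition qconj x : A :=
  mkquat (qcoef x 0) (- qcoef x 1) (- qcoef x 2) (- qcoef x 3).

(* x + qconj x lies in F; this is its value there, see qtrE. *)
Definition qtr x : F := qcoef (x + qconj x) 0.

Lemma qtrE x : (qtr x)%:A = x + qconj x.
Proof. by rewrite /qtr /qconj; qringE. Qed.

Definition trace_form (alpha : F) x y : F := qtr (alpha *: (x * qconj y)).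

End QuaternionAlgebra.

(* The algebra obtained from A = (a, b / Q) by extension of scalars to R, i.e.
   A (x)_Q R: the R-algebra with the same basis 1, i, j, ij and the same
   structure constants. The canonical map A -> A (x)_Q R, x |-> x (x) 1, is
   quat_ext. *)
Notation quatR R a b := (quat (ratr a : Real.sort R) (ratr b)).

Section ScalarExtension.
Variables (R : realType) (a b : rat).
Implicit Types x y : quat a b.

Definition quat_ext x : quatR R a b := map_mx ratr x.

Lemma qcoef_ext x k : qcoef (quat_ext x) k = ratr (qcoef x k).
Proof. by rewrite /qcoef mxE. Qed.

Lemma quat_extM x y : quat_ext (x * y) = quat_ext x * quat_ext y.
Proof.
by apply: quatP; rewrite !qmulE qcoef_ext !qcoef_mk /= !qcoef_ext
  ?(rmorphD, rmorphN, rmorphM).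
Qed.

(* On A (x)_Q R, the form below is the R-bilinear extension of
   (x, y) |-> tr (alpha x (qconj y)). *)
Lemma trace_form_ext (alpha : rat) x y :
  trace_form (ratr alpha) (quat_ext x) (quat_ext y) =
  ratr (trace_form alpha x y).
Proof.
have extZ (c : rat) z : quat_ext (c *: z) = ratr c *: quat_ext z.
  by apply/rowP => k; rewrite !mxE rmorphM.
have extC z : quat_ext (qconj z) = qconj (quat_ext z).
  by apply: quatP; rewrite qcoef_ext !qcoef_mk !qcoef_ext ?rmorphN.
by rewrite /trace_form -extC -quat_extM -extZ /qtr -extC !qcoefD !qcoef_ext
  rmorphD.
Qed.

End ScalarExtension.

Definition totally_definite (R : realType) (a b : rat) : Prop :=
  exists f : {lrmorphism quatR R a b -> quat (-1 : R) (-1)}, bijective f.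

Definition is_order (a b : rat) (L : {pred quat a b}) : Prop :=
  [/\ subring_closed L,
      exists m (s : m.-tuple (quat a b)), forall x, x \in L <-> inIntSpan s x
    & exists2 e : seq (quat a b), basis_of fullv e & {subset e <= L}].

(* A lattice of full rank in a finite-dimensional real vector space (which is
   thus the lattice tensored with R) with a bilinear form; the lattice and
   positivity properties hold for the instances below and are not stored. *)
Record lattice (R : realType) := Lattice {
  ambient : vectType R;
  carrier : ambient -> Prop;
  bform : ambient -> ambient -> R
}.

Section Lattices.
Variable R : realType.
Implicit Types L M : lattice R.

Definition min_vector L (x : ambient L) : Prop :=
  [/\ carrier x, x != 0
    & forall y : ambient L, carrier y -> y != 0 -> bform x x <= bform y y].

Definition well_rounded L : Prop :=
  forall v : ambient L, exists2 X : seq (ambient L),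
    (forall x, x \in X -> min_vector x) & v \in <<X>>%VS.

Definition is_Zbasis L n (e : n.-tuple (ambient L)) : Prop :=
  (forall x : ambient L, carrier x <-> inIntSpan e x) /\
  (forall c : 'I_n -> int,
     \sum_(i < n) e`_i *~ c i = 0 -> forall i, c i = 0).

Definition is_Gram L n (G : 'M[R]_n) : Prop :=
  exists2 e : n.-tuple (ambient L),
    is_Zbasis e & G = \matrix_(i, j) bform e`_i e`_j.

Definition Gram_similar n (G1 G2 : 'M[R]_n) : Prop :=
  exists (r : R) (U : 'M[int]_n), [/\ 0 < r, U \in unitmx
    & G1 = r *: (map_mx intr U *m G2 *m (map_mx intr U)^T)].

Definition lattice_similar L M : Prop :=
  exists n (G1 G2 : 'M[R]_n),
    [/\ is_Gram L G1, is_Gram M G2 & Gram_similar G1 G2].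

(* Z^n with Gram matrix G in the standard basis. *)
Definition Gram_lattice n (G : 'M[R]_n) : lattice R := {|
  ambient := 'rV[R]_n;
  carrier := fun v => exists z : 'rV[int]_n, v = map_mx intr z;
  bform := fun x y => (x *m G *m y^T) 0 0
|}.

Definition orthogonal_sum L M : lattice R := {|
  ambient := (ambient L * ambient M)%type;
  carrier := fun v => carrier v.1 /\ carrier v.2;
  bform := fun x y => bform x.1 y.1 + bform x.2 y.2
|}.

Definition Z4_lattice : lattice R := Gram_lattice (1%:M : 'M[R]_4).

Definition D4_lattice : lattice R := {|
  ambient := 'rV[R]_4;
  carrier := fun v => exists2 z : 'rV[int]_4,
    (2 %| \sum_(i < 4) z 0 i)%Z & v = map_mx intr z;
  bform := fun x y => (x *m y^T) 0 0
|}.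

Definition A2_lattice : lattice R :=
  Gram_lattice (\matrix_(i < 2, j < 2) (if i == j then 2 else -1)).

Definition A2A2_lattice : lattice R := orthogonal_sum A2_lattice A2_lattice.

(* (L, b_alpha), viewed inside A (x)_Q R. *)
Definition order_lattice (alpha a b : rat) (L : {pred quat a b}) :
    lattice R := {|
  ambient := quatR R a b;
  carrier := fun v => exists2 x, x \in L & v = quat_ext R x;
  bform := trace_form (ratr alpha)
|}.

End Lattices.

(* Main.v *)
(* On an order L of a definite quaternion algebra, b_alpha(x, x) is 2 alpha
   times the reduced norm, which takes positive integer values on L \ {0} and is
   1 at 1. So the minimum vectors are the elements of norm 1, and L is
   well-rounded iff these span. If some element u of norm 1 has trace 1, choose
   it; otherwise take u of norm 1 and trace 0. For a second element v of norm 1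
   outside Q + Qu, the Gram matrix of (1, u, v, uv) is determined by tr u, tr v
   and tr(u vbar), for which positivity leaves three cases, up to replacing v by
   +-u^k v. In these cases rounding coordinates shows that any x in L differs
   from an integral combination of 1, u, v, uv by an element of norm < 1, that
   is by 0 (if tr u = 0, also norm 1 and trace +-1 could occur, but no such
   element exists by the choice of u). Conversely, the Z-span of 1, u, v, uv is
   an order in each of the cases. *)
Require Import Defs.
From HB Require Import structures.
From mathcomp Require Import all_boot all_order all_algebra ring lra zify.
From mathcomp Require Import boolp reals.

Set Implicit Arguments.
Unset Strict Implicit.
Unset Printing Implicit Defensive.

Import Order.TTheory GRing.Theory Num.Theory.
Local Open Scope ring_scope.

(** * Reduced norm and trace pairing *)

Section ReducedNorm.
Variables (F : fieldType) (a b : F).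
Implicit Types x y z u v w : quat a b.

Definition qnrd x : F :=
  qcoef x 0 ^+ 2 - a * qcoef x 1 ^+ 2 - b * qcoef x 2 ^+ 2
  + a * b * qcoef x 3 ^+ 2.

Definition qpair x y : F := qtr (x * qconj y).

Definition qcomb u v (q0 q1 q2 q3 : F) : quat a b :=
  q0 *: 1 + q1 *: u + q2 *: v + q3 *: (u * v).

(** The reduced norm of [qcomb u v q0 q1 q2 q3] for [u], [v] of norm 1 with [tau = tr u],
    [s = tr v], [t = tr(u vbar)]; the coefficient [s * tau - t] is [tr(uv)]. *)
Definition quadform (tau s t q0 q1 q2 q3 : F) : F :=
  q0 ^+ 2 + q1 ^+ 2 + q2 ^+ 2 + q3 ^+ 2
  + tau * (q0 * q1 + q2 * q3) + s * (q0 * q2 + q1 * q3)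
  + t * (q1 * q2) + (s * tau - t) * (q0 * q3).

(** The polarization of [quadform], that is, the Gram matrix of [1, u, v, uv] for [qpair]. *)
Definition quadgram (tau s t : F) : 'M[F]_4 :=
  \matrix_(i, j) nth 0 (nth [::]
    [:: [:: 2; tau; s; s * tau - t]; [:: tau; 2; t; s];
        [:: s; t; 2; tau]; [:: s * tau - t; s; tau; 2]] i) j.

Lemma qcoef0 k : qcoef (0 : quat a b) k = 0.
Proof. by rewrite /qcoef mxE. Qed.

Local Ltac qexpand :=
  rewrite /qcomb /qpair /qtr /qnrd ?qmulE ?qoneE /qmul /qone /qconj
    ?(qcoef_mk, qcoefD, qcoefN, qcoefZ, qcoef0) /=.
Local Ltac qfield := qexpand; ring.

Lemma trace_formE alpha x y : trace_form alpha x y = alpha * qpair x y.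
Proof. by rewrite /trace_form; qfield. Qed.

Lemma qnrd1 : qnrd 1 = 1. Proof. qfield. Qed.
Lemma qnrd0 : qnrd 0 = 0. Proof. qfield. Qed.
Lemma qnrdN x : qnrd (- x) = qnrd x. Proof. qfield. Qed.
Lemma qnrdM x y : qnrd (x * y) = qnrd x * qnrd y. Proof. qfield. Qed.
Lemma qnrdD x y : qnrd (x + y) = qnrd x + qpair x y + qnrd y.
Proof. qfield. Qed.
Lemma qpairC x y : qpair x y = qpair y x. Proof. qfield. Qed.
Lemma qpairDl x y z : qpair (x + y) z = qpair x z + qpair y z.
Proof. qfield. Qed.
Lemma qpairNr x y : qpair x (- y) = - qpair x y. Proof. qfield. Qed.
Lemma qpairZl c x y : qpair (c *: x) y = c * qpair x y. Proof. qfield. Qed.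
Lemma qpair1 x : qpair x 1 = qtr x. Proof. qfield. Qed.
Lemma qpair1l x : qpair 1 x = qtr x. Proof. qfield. Qed.
Lemma qpair_diag x : qpair x x = 2 * qnrd x. Proof. qfield. Qed.
Lemma qtr1 : qtr (1 : quat a b) = 2. Proof. qfield. Qed.
Lemma qtrN x : qtr (- x) = - qtr x. Proof. qfield. Qed.
Lemma qtrM x y : qtr (x * y) = qtr x * qtr y - qpair x y. Proof. qfield. Qed.
Lemma qpair_mull x y : qpair x (x * y) = qnrd x * qtr y. Proof. qfield. Qed.
Lemma qpair_mulr x y : qpair y (x * y) = qnrd y * qtr x. Proof. qfield. Qed.

(** Cayley-Hamilton for the reduced characteristic polynomial; its polarization is [qmul_swap]. *)
Lemma qmul_sqr x : x * x = qtr x *: x - (qnrd x)%:A.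
Proof. by apply: quatP; qfield. Qed.

Lemma qmul_swap u v :
  v * u = qtr u *: v - (qpair u v)%:A + qtr v *: u - u * v.
Proof. by apply: quatP; qfield. Qed.

Lemma qnrd_qcomb u v q0 q1 q2 q3 : qnrd u = 1 -> qnrd v = 1 ->
  qnrd (qcomb u v q0 q1 q2 q3) =
  quadform (qtr u) (qtr v) (qpair u v) q0 q1 q2 q3.
Proof.
(* With the norms kept symbolic this is a polynomial identity in the coordinates; the hypotheses of
   norm 1 enter only afterwards. *)
move=> nu nv.
transitivity (q0 ^+ 2 + q1 ^+ 2 * qnrd u + q2 ^+ 2 * qnrd v
   + q3 ^+ 2 * (qnrd u * qnrd v)
   + q0 * q1 * qtr u + q0 * q2 * qtr v
   + q0 * q3 * (qtr u * qtr v - qpair u v) + q1 * q2 * qpair u v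
   + q1 * q3 * (qnrd u * qtr v) + q2 * q3 * (qnrd v * qtr u)).
  by qfield.
by rewrite nu nv /quadform; ring.
Qed.

Definition quadbasis u v : 4.-tuple (quat a b) := [tuple 1; u; v; u * v].

Lemma quadgramE u v : qnrd u = 1 -> qnrd v = 1 ->
  (\matrix_(i, j) qpair (quadbasis u v)`_i (quadbasis u v)`_j) =
  quadgram (qtr u) (qtr v) (qpair u v).
Proof.
move=> nu nv; apply/matrixP=> -[[|[|[|[|//]]]] lti] [[|[|[|[|//]]]] ltj];
  rewrite !mxE /= ?qpair_diag ?qnrdM ?qnrd1 ?nu ?nv ?mulr1 //
    ?qpair1 ?qpair1l ?qtrM //.
- by rewrite mulrC.
- by rewrite qpair_mull nu mul1r.
- exact: qpairC.
- by rewrite qpair_mulr nv mul1r.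
- by rewrite mulrC.
- by rewrite qpairC qpair_mull nu mul1r.
- by rewrite qpairC qpair_mulr nv mul1r.
Qed.

Lemma sum_quadbasis u v (q : 'I_4 -> F) :
  \sum_(i < 4) q i *: (quadbasis u v)`_i = qcomb u v (q 0) (q 1) (q 2) (q 3).
Proof.
rewrite !big_ord_recl big_ord0 addr0 /qcomb /= !addrA.
have -> : lift ord0 (lift ord0 (lift ord0 ord0)) = 3 :> 'I_4 by apply: val_inj.
have -> : lift ord0 (lift ord0 ord0) = 2 :> 'I_4 by apply: val_inj.
by have -> : lift ord0 ord0 = 1 :> 'I_4 by apply: val_inj.
Qed.

Lemma dim_quat : \dim {:quat a b} = 4%N.
Proof. by rewrite dimvf dim_matrix. Qed.

End ReducedNorm.

(** * Anisotropy of the norm for negative [a] and [b] *)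

Section Definite.
Variables (F : realFieldType) (a b : F).
Hypotheses (a_lt0 : a < 0) (b_lt0 : b < 0).
Implicit Types x y z u v w : quat a b.

Lemma sum4_sqr_eq0 (c0 c1 c2 c3 y0 y1 y2 y3 : F) :
    0 < c0 -> 0 < c1 -> 0 < c2 -> 0 < c3 ->
    c0 * y0 ^+ 2 + c1 * y1 ^+ 2 + c2 * y2 ^+ 2 + c3 * y3 ^+ 2 = 0 ->
  [/\ y0 = 0, y1 = 0, y2 = 0 & y3 = 0].
Proof.
move=> c0p c1p c2p c3p sum0.
have h0 := mulr_ge0 (ltW c0p) (sqr_ge0 y0).
have h1 := mulr_ge0 (ltW c1p) (sqr_ge0 y1).
have h2 := mulr_ge0 (ltW c2p) (sqr_ge0 y2).
have h3 := mulr_ge0 (ltW c3p) (sqr_ge0 y3).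
have sqr0 (c y : F) : 0 < c -> c * y ^+ 2 = 0 -> y = 0.
  by move=> c_gt0 /eqP; rewrite mulf_eq0 gt_eqF //= sqrf_eq0 => /eqP.
by split; [apply: (sqr0 c0) | apply: (sqr0 c1) | apply: (sqr0 c2)
  | apply: (sqr0 c3)] => //; lra.
Qed.

Lemma qnrd_ge0 x : 0 <= qnrd x.
Proof.
rewrite /qnrd; move: (qcoef x 0) (qcoef x 1) (qcoef x 2) (qcoef x 3).
move=> x0 x1 x2 x3; have ab : 0 < a * b by rewrite nmulr_rgt0.
have := sqr_ge0 x0; have := mulr_ge0 (ltW ab) (sqr_ge0 x3).
have := mulr_le0_ge0 (ltW a_lt0) (sqr_ge0 x1).
have := mulr_le0_ge0 (ltW b_lt0) (sqr_ge0 x2).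
lra.
Qed.

Lemma qnrd_eq0 x : (qnrd x == 0) = (x == 0).
Proof.
apply/eqP/eqP=> [|->]; last exact: qnrd0.
rewrite /qnrd => nx.
have [|||||? ? ? ?] := @sum4_sqr_eq0 1 (- a) (- b) (a * b)
  (qcoef x 0) (qcoef x 1) (qcoef x 2) (qcoef x 3).
- by [].
- by rewrite oppr_gt0.
- by rewrite oppr_gt0.
- by rewrite nmulr_rgt0.
- by rewrite -[RHS]nx; ring.
by apply: quatP; rewrite qcoef0.
Qed.

Lemma qnrd_gt0 x : (0 < qnrd x) = (x != 0).
Proof. by rewrite lt_def qnrd_ge0 andbT qnrd_eq0. Qed.

(* (tau, s, t) = (tr u, tr v, tr (u vbar)) for Z^4, A_2 + A_2 and D_4. *)
Definition special_params (tau s t : F) : Prop :=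
  [\/ [/\ tau = 0, s = 0 & t = 0], [/\ tau = 1, s = 0 & t = 0]
    | [/\ tau = 1, s = 1 & t = 0]].

(** Completing squares from [q0] on writes the form as a sum of four squares with positive weights:
    1, 3/4, 1, 3/4 for [A_2 + A_2] and 1, 3/4, 2/3, 1/2 for [D_4]. *)
Lemma quadform_eq0 (tau s t : F) : special_params tau s t ->
  forall q0 q1 q2 q3, quadform tau s t q0 q1 q2 q3 = 0 ->
  [/\ q0 = 0, q1 = 0, q2 = 0 & q3 = 0].
Proof.
move=> hp q0 q1 q2 q3; rewrite /quadform.
case: hp => -[-> -> ->] Q0.
- by apply: (@sum4_sqr_eq0 1 1 1 1) => //; lra.
- have [|||||? ? ? ?] := @sum4_sqr_eq0 1 (3/4) 1 (3/4)
    (q0 + q1 / 2) q1 (q2 + q3 / 2) q3; try lra.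
  by split; lra.
- have [|||||? ? ? ?] := @sum4_sqr_eq0 1 (3/4) (2/3) (1/2)
    (q0 + q1 / 2 + q2 / 2 + q3 / 2) (q1 - q2 / 3 + q3 / 3)
    (q2 + q3 / 2) q3; try lra.
  by split; lra.
Qed.

(** A vanishing combination has norm 0, so [quadform_eq0] kills its coefficients; four independent
    elements fill dimension 4. *)
Lemma free_quadbasis u v : qnrd u = 1 -> qnrd v = 1 ->
  special_params (qtr u) (qtr v) (qpair u v) ->
  basis_of fullv (quadbasis u v).
Proof.
move=> nu nv hp; rewrite basisEfree subvf dim_quat size_tuple leqnn !andbT.
apply/freeP => q /=; rewrite sum_quadbasis => /eqP.
rewrite -qnrd_eq0 qnrd_qcomb // => /eqP /(quadform_eq0 hp) [q0 q1 q2 q3].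
case=> -[|[|[|[|//]]]] lti; [rewrite -q0|rewrite -q1|rewrite -q2|rewrite -q3];
  by congr q; apply: val_inj.
Qed.

End Definite.

(** * Integrality and rounding *)

(** The integers are integrally closed: the denominator of [r], raised to any power, divides the
    fixed nonzero [D], so it is 1. *)
Lemma rat_int_of_powers (r : rat) (D : int) : D != 0 ->
  (forall n, D%:~R * r ^+ n \is a Num.int) -> r \is a Num.int.
Proof.
move=> D0 intD; rewrite Qint_def.
have d_gt0 := denq_gt0 r.
have dvdD n : (denq r ^+ n %| D)%Z.
  have /intrP [k kE] := intD n.
  have /(Gauss_dvdzl _) <- : coprimez (denq r ^+ n) (numq r ^+ n).
    by rewrite coprimezXl // coprimezXr // coprimez_sym coprimezE coprime_num_den.
  suff -> : D * numq r ^+ n = k * denq r ^+ n by apply: dvdz_mull.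
  have dr0 : (denq r)%:~R ^+ n != 0 :> rat.
    by rewrite expf_neq0 // intr_eq0 denq_neq0.
  apply: (@intr_inj rat); rewrite !intrM !rmorphXn /= -kE -mulrA; congr (_ * _).
  by rewrite -exprMn -{2}[r]divq_num_den divfK // intr_eq0 denq_neq0.
(* The exponent [|D|] is large enough: a denominator [d] of at least 2 would give
   [d ^ |D| > |D|]. *)
have := dvdD `|D|%N => /dvdn_leq.
rewrite absz_gt0 D0 => /(_ isT); rewrite abszX => leD.
have : (`|denq r| <= 1)%N.
  rewrite leqNgt; apply/negP => d2.
  by have := ltn_expl `|D|%N d2; rewrite ltnNge leD.
by have := denq_gt0 r; lia.
Qed.

Lemma common_denominator (I : finType) (f : I -> rat) :
  exists2 D : int, D != 0 & forall i, D%:~R * f i \is a Num.int.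
Proof.
exists (\prod_i denq (f i)).
  by apply/prodf_neq0 => i _; rewrite denq_neq0.
move=> i; rewrite (bigD1 i) //= mulrC intrM mulrA -numqE.
by rewrite -intrM intr_int.
Qed.

Section Order.
Variables (a b : rat) (L : {pred quat a b}).
Implicit Types x y u v w : quat a b.

(** Finite generation bounds the denominators of all coordinates at once, so one integer [E] clears
    those of [qnrd y] for every [y] in [L]. Applied to the powers of [x], this bounds the
    denominators of all powers of [qnrd x]. *)
Lemma order_qnrd_int : is_order L -> {in L, forall x, qnrd x \is a Num.int}.
Proof.
case=> -[L1 LB LM] [m [s sP]] _.
have [D D0 intD] := common_denominator
  (fun p : 'I_m * 'I_4 => qcoef s`_p.1 p.2).
have coefD x k : x \in L -> D%:~R * qcoef x k \is a Num.int.
  case/sP=> c ->.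
  have -> : qcoef (\sum_(i < m) s`_i *~ c i) k = \sum_(i < m) qcoef s`_i k *~ c i.
    rewrite /qcoef summxE; apply: eq_bigr => i _.
    by rewrite -!scaler_int mxE mulrzl.
  rewrite mulr_sumr rpred_sum // => i _; rewrite mulrzAr rpredMz //.
  exact: (intD (i, k)).
have Lexp x n : x \in L -> x ^+ n \in L.
  by move=> Lx; elim: n => [|n IH]; rewrite ?expr0 ?exprS //; apply: LM.
move=> x Lx.
(* [D ^+ 2] clears the squared coordinates; the other factors clear the coefficients [a], [b] and
   [a * b]. *)
pose E := D ^+ 2 * (denq a * denq b).
apply: (@rat_int_of_powers _ E).
  by rewrite !mulf_neq0 ?expf_neq0 ?denq_neq0.
move=> n; have -> : qnrd x ^+ n = qnrd (x ^+ n).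
  by elim: n => [|n IH]; rewrite ?expr0 ?qnrd1 // !exprS qnrdM IH.
have := Lexp x n Lx; move: (x ^+ n) => y {x Lx} Ly.
set A := denq a; set B := denq b.
have intA : A%:~R * a \is a Num.int by rewrite mulrC -numqE.
have intB : B%:~R * b \is a Num.int by rewrite mulrC -numqE.
have -> : E%:~R * qnrd y = A%:~R * B%:~R * (D%:~R * qcoef y 0) ^+ 2
   - A%:~R * a * B%:~R * (D%:~R * qcoef y 1) ^+ 2
   - A%:~R * (B%:~R * b) * (D%:~R * qcoef y 2) ^+ 2
   + A%:~R * a * (B%:~R * b) * (D%:~R * qcoef y 3) ^+ 2.
  by rewrite /E /qnrd expr2 !intrM; ring.
move: (coefD y 0 Ly) (coefD y 1 Ly) (coefD y 2 Ly) (coefD y 3 Ly) intA intB.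
move: (_ * qcoef y 0) (_ * qcoef y 1) (_ * qcoef y 2) (_ * qcoef y 3).
move: (_ * a) (_ * b) => p q c0 c1 c2 c3 ? ? ? ? ? ?.
by rewrite !(rpredD, rpredN, rpredM, rpredX) // intr_int.
Qed.

Hypothesis Lring : subring_closed L.
Hypothesis Lnrd : {in L, forall x, qnrd x \is a Num.int}.

Lemma order_qpair_int x y : x \in L -> y \in L -> qpair x y \is a Num.int.
Proof.
move=> Lx Ly; have -> : qpair x y = qnrd (x + y) - qnrd x - qnrd y.
  by rewrite qnrdD; ring.
have LD : x + y \in L.
  have [_ LB _] := Lring; have L0 : 0 \in L by rewrite -(subrr x) LB.
  by rewrite -[y]opprK LB // -sub0r LB.
by rewrite !rpredB ?Lnrd.
Qed.

Lemma order_qtr_int x : x \in L -> qtr x \is a Num.int.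
Proof.
by move=> Lx; rewrite -qpair1; apply: order_qpair_int => //; case: Lring.
Qed.

End Order.

Lemma rat_round (q : rat) : exists m : int, -(1/2) <= q - m%:~R <= 1/2.
Proof.
exists (Num.floor (q + 1/2)).
have := floor_le (q + 1/2); have := floorD1_gt (q + 1/2).
by rewrite intrD => h1 h2; apply/andP; split; lra.
Qed.

(** Rounding runs from [q3] back to [q0], each integer being chosen to make one completed square of
    [quadform_eq0] at most 1/4. The total is at most 7/8 for [A_2 + A_2] and 35/48 for [D_4]; for
    [Z^4] it is at most 1, with equality only if every square is 1/4. *)
Lemma quadform_round (tau s t : rat) : special_params tau s t ->
  forall q0 q1 q2 q3, exists m0 m1 m2 m3 : int,
  let Q := quadform tau s t
    (q0 - m0%:~R) (q1 - m1%:~R) (q2 - m2%:~R) (q3 - m3%:~R) in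
  Q < 1 \/ [/\ tau = 0, s = 0, t = 0, Q = 1 & (q0 - m0%:~R) ^+ 2 = 1/4].
Proof.
have sq (y : rat) : -(1/2) <= y <= 1/2 -> y ^+ 2 <= 1/4.
  by case/andP=> h1 h2; nra.
move=> hp q0 q1 q2 q3; rewrite /quadform.
case: hp => -[-> -> ->].
- have [m3 /sq h3] := rat_round q3; have [m2 /sq h2] := rat_round q2.
  have [m1 /sq h1] := rat_round q1; have [m0 /sq h0] := rat_round q0.
  exists m0, m1, m2, m3 => /=.
  move: (q0 - _) (q1 - _) (q2 - _) (q3 - _) => d0 d1 d2 d3 in h0 h1 h2 h3 *.
  set Q := (X in X < 1).
  have {Q}-> : Q = d0 ^+ 2 + d1 ^+ 2 + d2 ^+ 2 + d3 ^+ 2 by rewrite /Q; ring.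
  have [|le1] := ltP (d0 ^+ 2 + d1 ^+ 2 + d2 ^+ 2 + d3 ^+ 2) 1; first by left.
  by right; split=> //; lra.
- have [m3 /sq h3] := rat_round q3.
  have [m2 /sq h2] := rat_round (q2 + (q3 - m3%:~R) / 2).
  have [m1 /sq h1] := rat_round q1.
  have [m0 /sq h0] := rat_round (q0 + (q1 - m1%:~R) / 2).
  by exists m0, m1, m2, m3 => /=; left; lra.
- have [m3 /sq h3] := rat_round q3.
  have [m2 /sq h2] := rat_round (q2 + (q3 - m3%:~R) / 2).
  have [m1 /sq h1] :=
    rat_round (q1 - (q2 - m2%:~R) / 3 + (q3 - m3%:~R) / 3).
  have [m0 /sq h0] := rat_round
    (q0 + (q1 - m1%:~R) / 2 + (q2 - m2%:~R) / 2 + (q3 - m3%:~R) / 2).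
  by exists m0, m1, m2, m3 => /=; left; lra.
Qed.

(** * Orders spanned by elements of norm 1 *)

Lemma int_sqr_lt4 (k : int) : k ^+ 2 < 4 -> k = 0 \/ k = 1 \/ k = -1.
Proof.
move=> k4; have k_lt2 : k < 2 by nra.
have k_gtN2 : -2 < k by nra.
lia.
Qed.

(** The hexagonal norm form does not take the value 2, which leaves the origin and the six units.
    The units are listed so that the map [(s, t) -> (s - t, s)] sends each to the one before it. *)
Lemma int_hex_lt3 (s t : int) : s ^+ 2 - s * t + t ^+ 2 < 3 ->
  (s = 0 /\ t = 0) \/ (s = 1 /\ t = 0) \/ (s = 0 /\ t = -1) \/
  (s = -1 /\ t = -1) \/ (s = -1 /\ t = 0) \/ (s = 0 /\ t = 1) \/
  (s = 1 /\ t = 1).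
Proof.
move=> st.
(* Four times the form is [(2 s - t)^2 + 3 t^2], and symmetrically in [s]. *)
have /int_sqr_lt4 t1 : t ^+ 2 < 4 by have := sqr_ge0 (2 * s - t); lra.
have /int_sqr_lt4 s1 : s ^+ 2 < 4 by have := sqr_ge0 (2 * t - s); lra.
by move: st; case: s1 => [->|[->|->]]; case: t1 => [->|[->|->]] //; lia.
Qed.

Lemma int_sum_sqr_lt4 (s t : int) :
  s ^+ 2 + t ^+ 2 < 4 -> s ^+ 2 != 1 -> t ^+ 2 != 1 -> s = 0 /\ t = 0.
Proof.
move=> st; have s4 : s ^+ 2 < 4 by have := sqr_ge0 t; lra.
have t4 : t ^+ 2 < 4 by have := sqr_ge0 s; lra.
by case: (int_sqr_lt4 s4) => [|[]] ->; case: (int_sqr_lt4 t4) => [|[]] ->.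
Qed.

Section Generators.
Variables (a b : rat) (L : {pred quat a b}).
Hypotheses (a_lt0 : a < 0) (b_lt0 : b < 0).
Hypothesis Lring : subring_closed L.
Hypothesis Lnrd : {in L, forall x, qnrd x \is a Num.int}.
Implicit Types x y u v w : quat a b.

Definition norm1 u := u \in L /\ qnrd u = 1.

Lemma order_intZ (m : int) x : x \in L -> m%:~R *: x \in L.
Proof.
case: Lring => _ LB _ Lx; have L0 : 0 \in L by rewrite -(subrr x) LB.
have LN y : y \in L -> - y \in L by move=> Ly; rewrite -sub0r LB.
have LD y z : y \in L -> z \in L -> y + z \in L.
  by move=> Ly Lz; rewrite -[z]opprK LB ?LN.
have Ln (n : nat) : x *+ n \in L.
  by elim: n => [|n IH]; rewrite ?mulr0n ?mulrS ?LD.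
by rewrite scaler_int; case: m => n; rewrite ?NegzE ?mulrNz ?LN // -pmulrn.
Qed.

Lemma order_qcomb u v (m0 m1 m2 m3 : int) : u \in L -> v \in L ->
  qcomb u v m0%:~R m1%:~R m2%:~R m3%:~R \in L.
Proof.
move=> Lu Lv; have [L1 LB LM] := Lring.
have LD y z : y \in L -> z \in L -> y + z \in L.
  move=> Ly Lz; rewrite -[z]opprK LB // -sub0r LB //.
  by rewrite -(subrr y) LB.
by rewrite /qcomb !LD ?order_intZ // LM.
Qed.

(* Division with remainder: rounding the coordinates of x leaves an element of
   norm < 1, hence 0; for tau = 0 the remainder can have norm 1, but then its
   trace is +-1. *)
Lemma quadbasis_generates u v : norm1 u -> norm1 v ->
    special_params (qtr u) (qtr v) (qpair u v) ->
    (qtr u = 0 -> forall w, norm1 w -> qtr w ^+ 2 != 1) ->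
  forall x, x \in L ->
  exists m0 m1 m2 m3 : int, x = qcomb u v m0%:~R m1%:~R m2%:~R m3%:~R.
Proof.
move=> [Lu nu] [Lv nv] hp noneq x Lx.
have := coord_basis (free_quadbasis a_lt0 b_lt0 nu nv hp) (memvf x).
rewrite sum_quadbasis; move: (coord _ _ _) (coord _ _ _) (coord _ _ _) (coord _ _ _).
move=> q3 q2 q1 q0 xE.
have [m0 [m1 [m2 [m3 /= hQ]]]] := quadform_round hp q0 q1 q2 q3.
exists m0, m1, m2, m3.
set y := qcomb _ _ _ _ _ _; have Ly : y \in L by apply: order_qcomb.
have Lxy : x - y \in L by case: Lring => _ LB _; apply: LB.
have xyE : x - y =
    qcomb u v (q0 - m0%:~R) (q1 - m1%:~R) (q2 - m2%:~R) (q3 - m3%:~R).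
  rewrite xE /y /qcomb !scalerBl.
  by do 3!(rewrite opprD addrACA; congr (_ + _)).
rewrite -(qnrd_qcomb _ _ _ _ nu nv) -xyE in hQ.
case: hQ => [lt1 | [tau0 s0 t0 n1 sq]].
  apply/eqP; rewrite -subr_eq0 -(qnrd_eq0 a_lt0 b_lt0).
  have := qnrd_ge0 a_lt0 b_lt0 (x - y).
  have /intrP [k kE] := Lnrd Lxy; move: lt1; rewrite kE.
  rewrite ltrz1 ler0z => k_lt1 k_ge0.
  by have -> : k = 0 by lia.
(* As [u], [v] and [uv] have trace 0, the remainder has trace twice a number of square 1/4, against
   [noneq]. *)
have /eqP [] := noneq tau0 _ (conj Lxy n1).
rewrite xyE -qpair1 /qcomb !qpairDl !qpairZl !qpair1 qtrM qtr1 tau0 s0 t0.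
by rewrite mul0r subr0 !mulr0 !addr0 exprMn sq; lra.
Qed.

(** The rational form of well-roundedness: fewer than four elements never span all elements of norm
    1. It is derived in [well_rounded_unit_outside]. *)
Hypothesis unit_outside : forall X : seq (quat a b), (size X < 4)%N ->
  exists2 u, norm1 u & u \notin <<X>>%VS.

(** The value is the norm of [v - k0 - k1 u], which is nonzero. It is used with [k0], [k1] the
    coefficients of the orthogonal projection of [v] to the span of [1] and [u], where the
    inequality is sharpest. *)
Lemma notin_span_quadform u v k0 k1 : norm1 u -> norm1 v ->
  v \notin <<[:: 1; u]>>%VS ->
  0 < quadform (qtr u) (qtr v) (qpair u v) (- k0) (- k1) 1 0.
Proof.
move=> [Lu nu] [Lv nv] vP; rewrite -(qnrd_qcomb _ _ _ _ nu nv) qnrd_gt0 //.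
apply: contra vP; rewrite /qcomb scale1r scale0r addr0 !scaleNr addrC.
rewrite -opprD subr_eq0 => /eqP ->.
by rewrite rpredD // rpredZ // memv_span // !inE eqxx ?orbT.
Qed.

(** The component of [u] orthogonal to [1] has norm [1 - (tr u)^2 / 4], which is positive, and the
    trace is an integer. *)
Lemma norm1_trace u : norm1 u -> u \notin <<[:: 1 : quat a b]>>%VS ->
  qtr u = 0 \/ qtr u ^+ 2 = 1.
Proof.
move=> [Lu nu] uP.
have : 0 < qnrd (u - (qtr u / 2)%:A).
  rewrite qnrd_gt0 // subr_eq0; apply: contra uP => /eqP ->.
  by rewrite rpredZ // memv_span // inE.
rewrite qnrdD nu qpairC -scaleNr qpairZl qpair1l.
have -> : qnrd (- (qtr u / 2) *: (1 : quat a b)) = (qtr u / 2) ^+ 2.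
  have := qpair_diag (- (qtr u / 2) *: (1 : quat a b)).
  by rewrite qpairZl qpairC qpairZl qpair1 qtr1; lra.
have /intrP [k ->] := order_qtr_int Lring Lnrd Lu => h.
have : k ^+ 2 < 4 by rewrite -(ltr_int rat) rmorphXn /=; lra.
by case/int_sqr_lt4=> [->|[->|->]]; [left | right | right].
Qed.

Lemma norm1_mul u v : norm1 u -> norm1 v -> norm1 (u * v).
Proof.
case: Lring => _ _ LM [Lu nu] [Lv nv].
by split; [apply: LM | rewrite qnrdM nu nv mulr1].
Qed.

Lemma norm1_opp u : norm1 u -> norm1 (- u).
Proof.
case: Lring => L1 LB _ [Lu nu]; split; last by rewrite qnrdN.
by rewrite -sub0r LB // -(subrr u) LB.
Qed.

(* For qtr u = 1, multiplying v by u maps the pair (qtr v, qpair u v) = (s, t)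
   to (s - t, s); this permutes cyclically the six pairs with
   s^2 - s t + t^2 = 1. *)
Lemma exists_special_trace1 u : norm1 u -> qtr u = 1 ->
  exists2 v, norm1 v & special_params (qtr u) (qtr v) (qpair u v).
Proof.
move=> Nu tu; have [v Nv vP] := @unit_outside [:: 1; u] isT.
have [[Lu nu] [Lv nv]] := (Nu, Nv).
(* These coefficients solve [2 k0 + k1 = tr v] and [k0 + 2 k1 = qpair u v]; the remaining norm is
   [1 - (s^2 - s t + t^2) / 3]. *)
have := notin_span_quadform
  ((2 * qtr v - qpair u v) / 3) ((2 * qpair u v - qtr v) / 3) Nu Nv vP.
have /intrP [s sE] := order_qtr_int Lring Lnrd Lv.
have /intrP [t tE] := order_qpair_int Lring Lnrd Lu Lv.
rewrite /quadform tu sE tE => h.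
have : s%:~R ^+ 2 - s%:~R * t%:~R + t%:~R ^+ 2 < 3 :> rat by lra.
rewrite -!rmorphXn -rmorphM -rmorphB -rmorphD -[3]/(3%:~R) /= ltr_int => {h} st.
have step w : norm1 w -> norm1 (u * w) /\
    qtr (u * w) = qtr w - qpair u w /\ qpair u (u * w) = qtr w.
  by move=> Nw; rewrite qpair_mull qtrM tu nu !mul1r; split; first exact: norm1_mul.
have [Nuv [suv tuv]] := step _ Nv.
have [Nuuv [suuv tuuv]] := step _ Nuv.
have good w : norm1 w -> qtr w = 1 -> qpair u w = 0 ->
    exists2 v, norm1 v & special_params 1 (qtr v) (qpair u v).
  by move=> Nw sw tw; exists w => //; rewrite sw tw; apply: Or33.
(* The zero pair is the case [A_2 + A_2]; one of [v], [uv], [u^2 v] or their negatives brings each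
   other pair to [(1, 0)], the case [D_4]. *)
case: (int_hex_lt3 st) => [|[|[|[|[|[]]]]]] [s0 t0]; rewrite s0 t0 in sE tE.
- by exists v => //; rewrite sE tE; apply: Or32.
- by apply: good Nv _ _; rewrite ?sE ?tE.
- by apply: good Nuv _ _; rewrite ?suv ?tuv ?sE ?tE; lra.
- by apply: good Nuuv _ _; rewrite ?suuv ?tuuv ?suv ?tuv ?sE ?tE; lra.
- by apply: good (norm1_opp Nv) _ _; rewrite ?qtrN ?qpairNr ?sE ?tE; lra.
- by apply: good (norm1_opp Nuv) _ _; rewrite ?qtrN ?qpairNr ?suv ?tuv ?sE ?tE; lra.
- apply: good (norm1_opp Nuuv) _ _;
    by rewrite ?qtrN ?qpairNr ?suuv ?tuuv ?suv ?tuv ?sE ?tE; lra.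
Qed.

(** If some element of norm 1 has trace 1, it serves as [u]. Otherwise, up to sign, no element of
    norm 1 has trace 1 or -1, so [u] has trace 0, and positivity together with this exclusion for
    [v] and [uv] forces the parameters of [Z^4]. *)
Lemma exists_special_generators : exists u v, [/\ norm1 u, norm1 v,
    special_params (qtr u) (qtr v) (qpair u v)
  & qtr u = 0 -> forall w, norm1 w -> qtr w ^+ 2 != 1].
Proof.
have [[u [Nu tu]]|no1] := EM (exists u, norm1 u /\ qtr u = 1).
  have [v Nv hp] := exists_special_trace1 Nu tu.
  by exists u, v; split=> // /eqP; rewrite tu oner_eq0.
have no w : norm1 w -> qtr w ^+ 2 != 1.
  move=> Nw; rewrite sqrf_eq1; apply/negP => /orP [] /eqP tw.
    by apply: no1; exists w.
  by apply: no1; exists (- w); rewrite qtrN tw opprK; split=> //; apply: norm1_opp.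
have [u Nu uP] := @unit_outside [:: 1] isT.
have [v Nv vP] := @unit_outside [:: 1; u] isT.
have [tu|/eqP] := norm1_trace Nu uP; last by rewrite (negPf (no u Nu)).
exists u, v; split=> //.
have [[Lu nu] [Lv nv]] := (Nu, Nv).
(* Here [1] and [u] are orthogonal, so the projection has coefficients [s / 2] and [t / 2] and
   leaves the norm [1 - (s^2 + t^2) / 4]. *)
have := notin_span_quadform (qtr v / 2) (qpair u v / 2) Nu Nv vP.
(* As [tr u = 0], the trace of [uv] is [-t]; this excludes [t^2 = 1]. *)
have := no _ (norm1_mul Nu Nv); have := no _ Nv.
rewrite qtrM tu mul0r sub0r sqrrN.
have /intrP [s ->] := order_qtr_int Lring Lnrd Lv.
have /intrP [t ->] := order_qpair_int Lring Lnrd Lu Lv.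
rewrite -!rmorphXn /= !(eqr_int _ _ 1) => s1 t1; rewrite /quadform => h.
have : s%:~R ^+ 2 + t%:~R ^+ 2 < 4 :> rat by lra.
rewrite -!rmorphXn -rmorphD -[4]/(4%:~R) /= ltr_int => {h} st.
have [-> ->] := int_sum_sqr_lt4 st s1 t1.
exact: Or31.
Qed.
End Generators.

(** * Extension of scalars to the reals *)

Section HamiltonIso.
Variables (R : realType) (p q : R).

(** The algebra map with [i -> p i] and [j -> q j], hence [ij -> p q ij]. *)
Definition to_hamilton (x : quat (- p ^+ 2) (- q ^+ 2)) : quat (-1 : R) (-1) :=
  mkquat _ _ (qcoef x 0) (p * qcoef x 1) (q * qcoef x 2) (p * q * qcoef x 3).

Local Ltac qfield :=
  apply: quatP; rewrite /to_hamilton ?qmulE ?qoneE /qmul /qone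
    ?(qcoef_mk, qcoefD, qcoefN, qcoefZ) /=; ring.

Fact to_hamilton_is_additive : zmod_morphism to_hamilton.
Proof. by move=> x y; qfield. Qed.
Fact to_hamilton_is_monoid : monoid_morphism to_hamilton.
Proof. by split=> [|x y]; qfield. Qed.
Fact to_hamilton_is_scalable : scalable to_hamilton.
Proof. by move=> c x; qfield. Qed.

HB.instance Definition _ := GRing.isZmodMorphism.Build
  (quat (- p ^+ 2) (- q ^+ 2)) (quat (-1 : R) (-1))
  to_hamilton to_hamilton_is_additive.
HB.instance Definition _ := GRing.isMonoidMorphism.Build
  (quat (- p ^+ 2) (- q ^+ 2)) (quat (-1 : R) (-1))
  to_hamilton to_hamilton_is_monoid.
HB.instance Definition _ := GRing.isScalable.Build R
  (quat (- p ^+ 2) (- q ^+ 2)) (quat (-1 : R) (-1)) *:%R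
  to_hamilton to_hamilton_is_scalable.

Lemma to_hamilton_bij : p != 0 -> q != 0 -> bijective to_hamilton.
Proof.
move=> p0 q0; exists (fun x : quat (-1 : R) (-1) => mkquat _ _ (qcoef x 0)
  (p^-1 * qcoef x 1) (q^-1 * qcoef x 2) ((p * q)^-1 * qcoef x 3)) => x;
  apply: quatP; rewrite /to_hamilton !qcoef_mk //= ?qcoef_mk /=;
  by rewrite ?mulKf ?mulVKf ?mulf_neq0.
Qed.

End HamiltonIso.

Section TotallyDefinite.
Variable R : realType.

Lemma totally_definite_neg (a b : rat) : a < 0 -> b < 0 ->
  totally_definite R a b.
Proof.
move=> a_lt0 b_lt0; rewrite /totally_definite.
have : ratr a < 0 :> R by rewrite ltrq0.
have : ratr b < 0 :> R by rewrite ltrq0.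
move: (ratr a) (ratr b) => x y y0 x0.
have sqrt_ex (z : R) : z < 0 -> exists2 r, r != 0 & z = - r ^+ 2.
  move=> z0; exists (Num.sqrt (- z)).
    by rewrite gt_eqF // sqrtr_gt0 oppr_gt0.
  by rewrite sqr_sqrtr ?opprK // oppr_ge0 ltW.
have [p p0 ->] := sqrt_ex _ x0; have [q q0 ->] := sqrt_ex _ y0.
exists (@to_hamilton R p q : {lrmorphism _ -> _}).
exact: to_hamilton_bij.
Qed.

(* A nonscalar square root of c >= 0 would yield zero divisors. *)
Lemma totally_definite_no_sqrt (a b : rat) (x : quatR R a b) (c : R) :
  totally_definite R a b -> 0 <= c -> x * x = c%:A -> exists d : R, x = d%:A.
Proof.
case=> f /bij_inj f_inj c_ge0 xx.
have [r rr] : exists r : R, r * r = c.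
  by exists (Num.sqrt c); rewrite -expr2 sqr_sqrtr.
have prod0 : (x - r%:A) * (x + r%:A) = 0.
  rewrite mulrDr !mulrBl xx -!scalerAl -!scalerAr !mul1r mulr1 scalerA rr.
  by rewrite addrA subrK subrr.
(* In the Hamilton quaternions the norm is multiplicative and anisotropic, so one of the two factors
   has image 0. *)
have /eqP := congr1 (fun z => qnrd (f z)) prod0.
rewrite /= rmorphM raddf0 qnrdM qnrd0 mulf_eq0.
have m1 : -1 < 0 :> R by rewrite oppr_lt0 ltr01.
rewrite !(qnrd_eq0 m1 m1) !raddf_eq0 //.
case/orP; [rewrite subr_eq0 | rewrite addr_eq0] => /eqP ->; first by exists r.
by exists (- r); rewrite scaleNr.
Qed.

(** A positive [a] would make [i] a nonscalar square root of a positive real; likewise for [b] and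
    [j]. *)
Lemma totally_definite_lt0 (a b : rat) : a != 0 -> b != 0 ->
  totally_definite R a b -> a < 0 /\ b < 0.
Proof.
move=> a0 b0 td; split; rewrite lt_neqAle (a0, b0) /=;
  rewrite leNgt; apply/negP => gt0.
- have [|d] := totally_definite_no_sqrt td _ (qi_sqr (ratr a : R) (ratr b)).
    by rewrite ler0q ltW.
  move/(congr1 (fun x : quatR R a b => qcoef x 1)).
  rewrite /qi qcoef_mk qcoefZ qoneE qcoef_mk /= mulr0 => /eqP.
  by rewrite oner_eq0.
- have [|d] := totally_definite_no_sqrt td _ (qj_sqr (ratr a : R) (ratr b)).
    by rewrite ler0q ltW.
  move/(congr1 (fun x : quatR R a b => qcoef x 2)).
  rewrite /qj qcoef_mk qcoefZ qoneE qcoef_mk /= mulr0 => /eqP.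
  by rewrite oner_eq0.
Qed.

End TotallyDefinite.

Section QuatExt.
Variables (R : realType) (a b : rat).
Local Notation ext := (@quat_ext R a b).
Implicit Types x y u v : quat a b.

Lemma quat_extZ c x : ext (c *: x) = ratr c *: ext x.
Proof. by apply/rowP => k; rewrite !mxE rmorphM. Qed.

Lemma quat_ext_is_additive : zmod_morphism ext.
Proof. by move=> x y; apply/rowP => k; rewrite !mxE rmorphB. Qed.

HB.instance Definition _ := GRing.isZmodMorphism.Build (quat a b) (quatR R a b)
  (@quat_ext R a b) quat_ext_is_additive.

Lemma quat_ext_inj : injective ext.
Proof.
move=> x y /rowP xy; apply/rowP => k; move: (xy k); rewrite !mxE.
exact: fmorph_inj.
Qed.

Lemma quat_ext1 : ext 1 = 1.
Proof.
apply: quatP; rewrite qcoef_ext !qoneE !qcoef_mk /= ?rmorph0 ?rmorph1 //.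
Qed.

Lemma qpair_ext x y : qpair (ext x) (ext y) = ratr (qpair x y).
Proof.
by have := trace_form_ext R 1 x y; rewrite !trace_formE rmorph1 !mul1r.
Qed.

Lemma qnrd_ext x : qnrd (ext x) = ratr (qnrd x).
Proof.
by rewrite /qnrd !qcoef_ext !(rmorphB, rmorphD, rmorphM, rmorphXn).
Qed.

Lemma qtr_ext x : qtr (ext x) = ratr (qtr x).
Proof. by rewrite -!qpair1 -qpair_ext quat_ext1. Qed.

Lemma ext_quadbasis u v (i : 'I_4) :
  (quadbasis (ext u) (ext v))`_i = ext (quadbasis u v)`_i.
Proof.
by case: i => -[|[|[|[|//]]]] lti //=; rewrite ?quat_ext1 ?quat_extM.
Qed.

Lemma ext_span (X : seq (quat a b)) x :
  x \in <<X>>%VS -> ext x \in <<map ext X>>%VS.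
Proof.
move=> /(coord_span (X := in_tuple X)) ->.
rewrite raddf_sum /= memv_suml // => i _; rewrite /= quat_extZ memvZ //.
by rewrite memv_span // map_f // mem_nth.
Qed.

End QuatExt.

(** * Minimum vectors and Gram matrices of order lattices *)

Section OrderLattice.
Variables (R : realType) (a b alpha : rat) (L : {pred quat a b}).
Hypotheses (a_lt0 : a < 0) (b_lt0 : b < 0) (alpha_gt0 : 0 < alpha).
Hypothesis Lring : subring_closed L.
Hypothesis Lnrd : {in L, forall x, qnrd x \is a Num.int}.
Local Notation ext := (@quat_ext R a b).
Local Notation OL := (order_lattice R alpha L).
Implicit Types x y u v : quat a b.

Lemma trace_form_diag x :
  trace_form (ratr alpha) (ext x) (ext x) = ratr (alpha * 2 * qnrd x).
Proof. by rewrite trace_form_ext trace_formE qpair_diag mulrA. Qed.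

(** A minimum vector is compared with [1]; conversely, norm 1 is least because the norms of nonzero
    elements of [L] are positive integers. *)
Lemma min_vector_norm1 (w : ambient OL) : min_vector w <->
  exists2 u, norm1 L u & w = ext u.
Proof.
have a2 : 0 < alpha * 2 by rewrite mulr_gt0.
split.
  case=> -[u Lu ->] u0 umin; exists u => //; split=> //.
  have L1 : 1 \in L by case: Lring.
  have := umin (ext 1) (ex_intro2 _ _ 1 L1 erefl).
  rewrite /= !trace_form_diag ler_rat qnrd1 ler_pM2l //.
  rewrite quat_ext1 oner_neq0 => /(_ isT).
  have : 0 < qnrd u.
    by rewrite qnrd_gt0 //; apply: contra u0 => /eqP ->; rewrite raddf0.
  have /intrP [k ->] := Lnrd Lu.
  by rewrite ltr0z lerz1 => k0 k1; have -> : k = 1 by lia.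
case=> u [Lu nu] ->; split; first by exists u.
  rewrite -(raddf0 ext) (inj_eq (@quat_ext_inj R a b)).
  by rewrite -qnrd_gt0 // nu.
move=> _ [y Ly ->] y0; rewrite /= !trace_form_diag ler_rat nu ler_pM2l //.
have : 0 < qnrd y.
  by rewrite qnrd_gt0 //; apply: contra y0 => /eqP ->; rewrite raddf0.
have /intrP [k ->] := Lnrd Ly.
by rewrite ltr0z ler1z; lia.
Qed.

(** If the span of [X] contained all elements of norm 1, the real span of its image would contain
    all minimum vectors, hence the whole space, which has dimension 4. *)
Lemma well_rounded_unit_outside : well_rounded OL ->
  forall X : seq (quat a b), (size X < 4)%N ->
  exists2 u, norm1 L u & u \notin <<X>>%VS.
Proof.
move=> wr X ltX; apply: contrapT => noX.
have inX u : norm1 L u -> u \in <<X>>%VS.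
  by move=> Nu; apply: contraPT noX => uX; apply; exists u.
have full : (fullv <= <<map ext X>>)%VS.
  apply/subvP => v _; have [Y Ymin] := wr v.
  apply: subvP v; apply/span_subvP => y /Ymin /min_vector_norm1 [u Nu ->].
  exact/ext_span/inX.
have := dimvS full; rewrite dim_quat => /leq_trans /(_ (dim_span _)).
by rewrite size_map leqNgt ltX.
Qed.

(** The elements [1, u, v, uv] are minimum vectors, and extension of scalars preserves the special
    parameters, so they remain a basis over the reals. *)
Lemma well_rounded_quadbasis u v : norm1 L u -> norm1 L v ->
  special_params (qtr u) (qtr v) (qpair u v) -> well_rounded OL.
Proof.
move=> Nu Nv hp w; exists (quadbasis (ext u) (ext v)).
  have N1 : norm1 L 1 by case: Lring => L1 _ _; split; rewrite ?qnrd1.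
  have Nuv : norm1 L (u * v) by apply: norm1_mul.
  move=> x; rewrite !inE -quat_ext1 -quat_extM => x_in; apply/min_vector_norm1.
  by case/or4P: x_in => /eqP ->; [exists 1 | exists u | exists v | exists (u * v)].
have a'_lt0 : ratr a < 0 :> R by rewrite ltrq0.
have b'_lt0 : ratr b < 0 :> R by rewrite ltrq0.
have [[_ nu] [_ nv]] := (Nu, Nv).
rewrite (span_basis (free_quadbasis a'_lt0 b'_lt0 _ _ _)) ?memvf //.
- by rewrite qnrd_ext nu rmorph1.
- by rewrite qnrd_ext nv rmorph1.
rewrite !qtr_ext qpair_ext.
case: hp => -[-> -> ->]; rewrite ?rmorph0 ?rmorph1.
- exact: Or31.
- exact: Or32.
- exact: Or33.
Qed.

Lemma order_lattice_Gram u v : norm1 L u -> norm1 L v ->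
    special_params (qtr u) (qtr v) (qpair u v) ->
    (forall x, x \in L -> exists m0 m1 m2 m3 : int,
       x = qcomb u v m0%:~R m1%:~R m2%:~R m3%:~R) ->
  is_Gram OL (ratr alpha *:
    quadgram (ratr (qtr u)) (ratr (qtr v)) (ratr (qpair u v))).
Proof.
move=> [Lu nu] [Lv nv] hp gen.
(* Integral combinations in the real algebra come from the rational one, where generation and
   independence are known. *)
have sumE (c : 'I_4 -> int) :
    \sum_(i < 4) (quadbasis (ext u) (ext v))`_i *~ c i
  = ext (qcomb u v (c 0)%:~R (c 1)%:~R (c 2)%:~R (c 3)%:~R).
  rewrite -(sum_quadbasis u v (fun i => (c i)%:~R)) raddf_sum; apply: eq_bigr => i _ /=.
  by rewrite ext_quadbasis quat_extZ ratr_int scaler_int.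
exists (quadbasis (ext u) (ext v)); first split.
- move=> x; split.
    case=> y /gen [m0 [m1 [m2 [m3 ->]]]] ->.
    by exists [ffun i : 'I_4 => [:: m0; m1; m2; m3]`_i]; rewrite sumE !ffunE.
  case=> c ->; rewrite sumE; eexists; last reflexivity.
  exact: order_qcomb.
- move=> c; rewrite sumE -(raddf0 ext) => /quat_ext_inj.
  rewrite -(sum_quadbasis u v (fun i => (c i)%:~R)).
  move/(freeP (basis_free (free_quadbasis a_lt0 b_lt0 nu nv hp))).
  by move=> + i => /(_ i) /eqP; rewrite intr_eq0 => /eqP.
rewrite -qpair_ext -!qtr_ext -quadgramE ?qnrd_ext ?nu ?nv ?rmorph1 //.
by apply/matrixP => i j; rewrite !mxE /= trace_formE.
Qed.

End OrderLattice.

(** * The order spanned by 1, u, v, uv *)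

Section SpanMul.
Variables (F : fieldType) (a b : F).
Implicit Types u v : quat a b.

(** Left multiplication by [u] in terms of [1, u, v, uv], from [qmul_sqr]. Its coefficients, like
    those for [v] below, are integral when the three parameters are. *)
Lemma mul_qcombl u v q0 q1 q2 q3 : qnrd u = 1 ->
  u * qcomb u v q0 q1 q2 q3 =
  qcomb u v (- q1) (q0 + qtr u * q1) (- q3) (q2 + qtr u * q3).
Proof.
move=> nu; rewrite /qcomb !mulrDr -!scalerAr mulr1 mulrA qmul_sqr nu.
rewrite mulrBl -!scalerAl mul1r.
move: (u * v) (1 : quat a b) (qtr u) => w e t.
by apply/rowP => k; rewrite !mxE; ring.
Qed.

Lemma mul_qcombr u v q0 q1 q2 q3 : qnrd v = 1 ->
  v * qcomb u v q0 q1 q2 q3 =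
  qcomb u v (- (qpair u v * q1) - q2 - qtr u * q3) (qtr v * q1 + q3)
    (q0 + qtr u * q1 + qtr v * q2 + (qtr u * qtr v - qpair u v) * q3) (- q1).
Proof.
move=> nv; rewrite /qcomb !mulrDr -!scalerAr mulr1 (mulrA v u v) (qmul_swap u v).
rewrite !mulrDl !mulNr -!scalerAl mul1r -(mulrA u v v) (qmul_sqr v) nv.
rewrite mulrBr -!scalerAr mulr1.
(* All products are now reduced to [1, u, v, uv]; what remains is linear in these and holds for
   arbitrary vectors. *)
move: (u * v) (1 : quat a b) (qtr u) (qtr v) (qpair u v) => w e tau s t.
by apply/rowP => k; rewrite !mxE; ring.
Qed.
End SpanMul.

Section SpanOrder.
Variables (a b : rat) (u v : quat a b).
Hypotheses (a_lt0 : a < 0) (b_lt0 : b < 0).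
Hypotheses (nu : qnrd u = 1) (nv : qnrd v = 1).
Hypothesis hp : special_params (qtr u) (qtr v) (qpair u v).
Implicit Types x y : quat a b.

Let basis_uv := free_quadbasis a_lt0 b_lt0 nu nv hp.

(** Integrality of coordinates makes membership in the integral span of [1, u, v, uv] a boolean
    predicate; [span_orderP] recovers the combinations. *)
Definition span_order : {pred quat a b} :=
  [pred x | [forall k, coord (quadbasis u v) k x \is a Num.int]].

Lemma span_orderP x : reflect
  (exists m0 m1 m2 m3 : int, x = qcomb u v m0%:~R m1%:~R m2%:~R m3%:~R)
  (x \in span_order).
Proof.
rewrite inE; apply: (iffP forallP) => [xint | [m0 [m1 [m2 [m3 ->]]]] k].
  rewrite (coord_basis basis_uv (memvf x)) sum_quadbasis.
  have /intrP [m0 ->] := xint 0; have /intrP [m1 ->] := xint 1.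
  have /intrP [m2 ->] := xint 2; have /intrP [m3 ->] := xint 3.
  by exists m0, m1, m2, m3.
have := sum_quadbasis u v (fun i : 'I_4 => ([:: m0; m1; m2; m3]`_i)%:~R).
by move=> /= <-; rewrite coord_sum_free ?intr_int // (basis_free basis_uv).
Qed.

Lemma span_order_lin (m : int) x y :
  x \in span_order -> y \in span_order -> m%:~R *: x + y \in span_order.
Proof.
rewrite !inE => /forallP xint /forallP yint; apply/forallP => k.
by rewrite linearD linearZ /= rpredD ?rpredM ?intr_int ?xint ?yint.
Qed.

Lemma special_params_int : exists tau s t : int,
  [/\ qtr u = tau%:~R, qtr v = s%:~R & qpair u v = t%:~R].
Proof.
by case: hp => -[-> -> ->]; [exists 0, 0, 0 | exists 1, 0, 0 | exists 1, 1, 0].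
Qed.

(** Closure under products reduces to left multiplication by the two generators: by [u] here, by [v]
    in [span_order_mulr]. *)
Lemma span_order_mull x : x \in span_order -> u * x \in span_order.
Proof.
case/span_orderP=> m0 [m1 [m2 [m3 ->]]]; rewrite mul_qcombl //.
have [tau [s [t [-> _ _]]]] := special_params_int.
apply/span_orderP; exists (- m1), (m0 + tau * m1), (- m3), (m2 + tau * m3).
by rewrite !(rmorphD, rmorphN, rmorphM).
Qed.

Lemma span_order_mulr x : x \in span_order -> v * x \in span_order.
Proof.
case/span_orderP=> m0 [m1 [m2 [m3 ->]]]; rewrite mul_qcombr //.
have [tau [s [t [-> -> ->]]]] := special_params_int.
apply/span_orderP; exists (- (t * m1) - m2 - tau * m3), (s * m1 + m3),
  (m0 + tau * m1 + s * m2 + (tau * s - t) * m3), (- m1).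
by rewrite !(rmorphD, rmorphN, rmorphM).
Qed.

Lemma span_order_norm1 : norm1 span_order 1 /\
  norm1 span_order u /\ norm1 span_order v.
Proof.
split; [|split]; split=> //; rewrite ?qnrd1 //; apply/span_orderP.
- by exists 1, 0, 0, 0; rewrite /qcomb !scale0r !addr0 scale1r.
- by exists 0, 1, 0, 0; rewrite /qcomb !scale0r !addr0 scale1r add0r.
- by exists 0, 0, 1, 0; rewrite /qcomb !scale0r !addr0 scale1r !add0r.
Qed.

Lemma span_order_is_order : is_order span_order.
Proof.
have [[L1 _] [[Lu _] [Lv _]]] := span_order_norm1.
split; first split=> //.
- move=> x y; rewrite !inE => /forallP xint /forallP yint; apply/forallP => k.
  by rewrite linearB rpredB ?xint ?yint.
- move=> x y /span_orderP [m0 [m1 [m2 [m3 ->]]]] Ly.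
  rewrite /qcomb !mulrDl -!scalerAl mul1r -mulrA -!addrA.
  have L0 : 0 \in span_order.
    by rewrite -(subrr 1) -scaleN1r addrC -[-1]/((-1)%:~R) span_order_lin.
  (* The added 0 gives the last term, too, the shape required by [span_order_lin]. *)
  rewrite -[_ *: (u * (v * y))]addr0.
  by rewrite !span_order_lin ?span_order_mull ?span_order_mulr.
- exists 4%N, (quadbasis u v) => x.
  have intE (c : int ^ 4) : \sum_(i < 4) (quadbasis u v)`_i *~ c i =
      qcomb u v (c 0)%:~R (c 1)%:~R (c 2)%:~R (c 3)%:~R.
    rewrite -(sum_quadbasis u v (fun i => (c i)%:~R)).
    by apply: eq_bigr => i _; rewrite scaler_int.
  split=> [/span_orderP [m0 [m1 [m2 [m3 ->]]]] | [c ->]].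
    by exists [ffun i : 'I_4 => [:: m0; m1; m2; m3]`_i]; rewrite intE !ffunE.
  by rewrite intE; apply/span_orderP; do 4!eexists.
- exists (quadbasis u v) => // x x_in.
  have : [|| x == 1, x == u, x == v | x == u * v] by move: x_in; rewrite !inE.
  by case/or4P => /eqP ->; rewrite ?span_order_mull.
Qed.

End SpanOrder.

(** * The lattices Z^4, D_4 and A_2 + A_2 *)

Section TargetLattices.
Variable R : realType.
Local Notation intmx := (map_mx (intr : int -> R)).

Definition irow2 (z0 z1 : int) : 'rV[int]_2 := \row_k nth 0 [:: z0; z1] k.
Definition irow4 (z0 z1 z2 z3 : int) : 'rV[int]_4 :=
  \row_k nth 0 [:: z0; z1; z2; z3] k.

Lemma irow2P (z : 'rV[int]_2) : z = irow2 (z 0 0) (z 0 1).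
Proof.
by apply/rowP => -[[|[|//]] lti]; rewrite mxE /=; congr (z 0 _); apply: val_inj.
Qed.

Lemma irow4P (z : 'rV[int]_4) : z = irow4 (z 0 0) (z 0 1) (z 0 2) (z 0 3).
Proof.
by apply/rowP => -[[|[|[|[|//]]]] lti]; rewrite mxE /=; congr (z 0 _);
  apply: val_inj.
Qed.

Lemma irow2_eq0 (z0 z1 : int) : intmx (irow2 z0 z1) = 0 -> z0 = 0 /\ z1 = 0.
Proof.
by move=> /rowP z; split; apply/eqP; rewrite -(intr_eq0 R);
  [have := z 0 | have := z 1]; rewrite !mxE => ->.
Qed.

Lemma irow4_eq0 (z0 z1 z2 z3 : int) : intmx (irow4 z0 z1 z2 z3) = 0 ->
  [/\ z0 = 0, z1 = 0, z2 = 0 & z3 = 0].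
Proof.
by move=> /rowP z; split; apply/eqP; rewrite -(intr_eq0 R);
  [have := z 0 | have := z 1 | have := z 2 | have := z 3]; rewrite !mxE => ->.
Qed.

Lemma dot_irow4 x0 x1 x2 x3 y0 y1 y2 y3 :
  (intmx (irow4 x0 x1 x2 x3) *m (intmx (irow4 y0 y1 y2 y3))^T) 0 0 =
  (x0 * y0 + x1 * y1 + x2 * y2 + x3 * y3)%:~R.
Proof.
by rewrite !mxE !big_ord_recl big_ord0 !mxE /= !intrD !intrM addr0 !addrA.
Qed.

Lemma Z4_bformE x0 x1 x2 x3 y0 y1 y2 y3 :
  bform (l := Z4_lattice R) (intmx (irow4 x0 x1 x2 x3))
    (intmx (irow4 y0 y1 y2 y3)) = (x0 * y0 + x1 * y1 + x2 * y2 + x3 * y3)%:~R.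
Proof. by rewrite /= mulmx1 dot_irow4. Qed.

Lemma A2_bformE x0 x1 y0 y1 :
  bform (l := A2_lattice R) (intmx (irow2 x0 x1)) (intmx (irow2 y0 y1)) =
  (2 * x0 * y0 - x0 * y1 - x1 * y0 + 2 * x1 * y1)%:~R.
Proof.
rewrite /= !mxE !big_ord_recl big_ord0 !mxE !big_ord_recl !big_ord0 !mxE /=.
by rewrite !(intrD, intrM, intrB, intrN); ring.
Qed.

Lemma A2A2_bformE x0 x1 x2 x3 y0 y1 y2 y3 :
  bform (l := A2A2_lattice R)
    (intmx (irow2 x0 x1), intmx (irow2 x2 x3))
    (intmx (irow2 y0 y1), intmx (irow2 y2 y3)) =
  (2 * x0 * y0 - x0 * y1 - x1 * y0 + 2 * x1 * y1
   + (2 * x2 * y2 - x2 * y3 - x3 * y2 + 2 * x3 * y3))%:~R.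
Proof. by rewrite intrD -!A2_bformE. Qed.

Lemma D4_carrierP (x : 'rV[R]_4) : carrier (l := D4_lattice R) x <->
  exists z0 z1 z2 z3 k : int, z0 + z1 + z2 + z3 = k * 2 /\
    x = intmx (irow4 z0 z1 z2 z3).
Proof.
split=> [[z] | [z0 [z1 [z2 [z3 [k [zE ->]]]]]]].
  rewrite !big_ord_recl big_ord0 => /dvdzP [k kE] ->.
  exists (z 0 0), (z 0 1), (z 0 2), (z 0 3), k; rewrite -irow4P; split=> //.
  rewrite -kE addr0 !addrA.
  by congr (z 0 _ + z 0 _ + z 0 _ + z 0 _); apply: val_inj.
exists (irow4 z0 z1 z2 z3) => //; apply/dvdzP; exists k.
by rewrite !big_ord_recl big_ord0 !mxE /= -zE addr0 !addrA.
Qed.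

Lemma Z4_Gram : is_Gram (Z4_lattice R) (1%:M : 'M[R]_4).
Proof.
pose e : 4.-tuple 'rV[R]_4 := [tuple intmx (irow4 1 0 0 0);
  intmx (irow4 0 1 0 0); intmx (irow4 0 0 1 0); intmx (irow4 0 0 0 1)].
have sumE (c : 'I_4 -> int) :
    \sum_(i < 4) e`_i *~ c i = intmx (irow4 (c 0) (c 1) (c 2) (c 3)).
  rewrite !big_ord_recl big_ord0 /=.
  apply/rowP => -[[|[|[|[|//]]]] lti]; rewrite -!scaler_int !mxE /=;
    rewrite !mulr1 !mulr0 ?addr0 ?add0r; congr (c _)%:~R; exact: val_inj.
exists e; first split.
- move=> x; split=> [[z ->] | [c ->]]; last by rewrite sumE; eexists.
  by exists [ffun i => z 0 i]; rewrite sumE !ffunE -irow4P.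
- move=> c; rewrite sumE => /irow4_eq0 [c0 c1 c2 c3] [[|[|[|[|//]]]] lti];
  [rewrite -c0 | rewrite -c1 | rewrite -c2 | rewrite -c3];
  by congr c; apply: val_inj.
apply/matrixP => -[[|[|[|[|//]]]] lti] [[|[|[|[|//]]]] ltj];
  by rewrite [LHS]mxE [RHS]mxE Z4_bformE.
Qed.

Lemma D4_Gram : is_Gram (D4_lattice R) (quadgram 1 1 0 : 'M[R]_4).
Proof.
(* Four roots of [D_4] with the inner products of [1, u, v, uv] for parameters 1, 1, 0. *)
pose e : 4.-tuple 'rV[R]_4 := [tuple intmx (irow4 1 1 0 0);
  intmx (irow4 1 0 1 0); intmx (irow4 0 1 0 1); intmx (irow4 1 0 0 1)].
have sumE (c : 'I_4 -> int) : \sum_(i < 4) e`_i *~ c i =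
    intmx (irow4 (c 0 + c 1 + c 3) (c 0 + c 2) (c 1) (c 2 + c 3)).
  rewrite !big_ord_recl big_ord0 /=.
  have -> : lift ord0 (lift ord0 (lift ord0 ord0)) = 3 :> 'I_4 by apply: val_inj.
  have -> : lift ord0 (lift ord0 ord0) = 2 :> 'I_4 by apply: val_inj.
  have -> : lift ord0 ord0 = 1 :> 'I_4 by apply: val_inj.
  apply/rowP => -[[|[|[|[|//]]]] lti]; rewrite -!scaler_int !mxE /= ?intrD;
  ring.
exists e; first split.
- move=> x; split=> [/D4_carrierP [z0 [z1 [z2 [z3 [k [zE ->]]]]]] | [c ->]].
    (* The solution of the system read off from [sumE], where [k] is half the sum of the
       coordinates. *)
    exists [ffun i : 'I_4 =>
      [:: k - z2 - z3; z2; k - z0; k - z2 - z1]`_i].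
    by rewrite sumE !ffunE /=; congr (intmx (irow4 _ _ _ _)); lia.
  rewrite sumE; apply/D4_carrierP; do 4!eexists.
  by exists (c 0 + c 1 + c 2 + c 3); split=> //; ring.
- move=> c; rewrite sumE => /irow4_eq0 [c0 c1 c2 c3].
  have c2_0 : c 2 = 0 by lia.
  have c0_0 : c 0 = 0 by lia.
  have c3_0 : c 3 = 0 by lia.
  move=> [[|[|[|[|//]]]] lti];
  [rewrite -c0_0 | rewrite -c2 | rewrite -c2_0 | rewrite -c3_0];
  by congr c; apply: val_inj.
apply/matrixP => -[[|[|[|[|//]]]] lti] [[|[|[|[|//]]]] ltj];
  by rewrite [LHS]mxE [RHS]mxE [RHS]dot_irow4 /=; ring.
Qed.

Lemma A2A2_Gram : is_Gram (A2A2_lattice R) (quadgram 1 0 0 : 'M[R]_4).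
Proof.
(* The second basis vector of each [A_2] is negated, since [quadgram 1 0 0] has 1 where the Gram
   matrix of [A_2] has -1. *)
pose e : 4.-tuple ('rV[R]_2 * 'rV[R]_2)%type := [tuple
  (intmx (irow2 1 0), intmx (irow2 0 0));
  (intmx (irow2 0 (-1)), intmx (irow2 0 0));
  (intmx (irow2 0 0), intmx (irow2 1 0));
  (intmx (irow2 0 0), intmx (irow2 0 (-1)))].
have sumE (c : 'I_4 -> int) : \sum_(i < 4) e`_i *~ c i =
    (intmx (irow2 (c 0) (- c 1)), intmx (irow2 (c 2) (- c 3))).
  rewrite !big_ord_recl big_ord0 /=.
  have -> : lift ord0 (lift ord0 (lift ord0 ord0)) = 3 :> 'I_4 by apply: val_inj.
  have -> : lift ord0 (lift ord0 ord0) = 2 :> 'I_4 by apply: val_inj.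
  have -> : lift ord0 ord0 = 1 :> 'I_4 by apply: val_inj.
  rewrite -!scaler_int; congr (_, _);
  by apply/rowP => -[[|[|//]] lti]; rewrite !mxE /= ?intrN; ring.
exists e; first split.
- move=> [x y]; split=> [[[z /= ->] [w /= ->]] | [c ->]].
    exists [ffun i : 'I_4 => [:: z 0 0; - z 0 1; w 0 0; - w 0 1]`_i].
    by rewrite sumE !ffunE /= !opprK -!irow2P.
  by rewrite sumE; split; eexists.
- move=> c; rewrite sumE => -[/irow2_eq0 [c0 c1] /irow2_eq0 [c2 c3]].
  have c1_0 : c 1 = 0 by lia.
  have c3_0 : c 3 = 0 by lia.
  move=> [[|[|[|[|//]]]] lti];
  [rewrite -c0 | rewrite -c1_0 | rewrite -c2 | rewrite -c3_0];
  by congr c; apply: val_inj.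
apply/matrixP => -[[|[|[|[|//]]]] lti] [[|[|[|[|//]]]] ltj];
  by rewrite [LHS]mxE [RHS]mxE A2A2_bformE /=; ring.
Qed.

End TargetLattices.

(** * Pairwise non-similarity of the three lattices *)

Section Similarity.
Variable R : realType.
Implicit Types L M : lattice R.
Local Notation intmx := (map_mx (intr : int -> R)).

Lemma Gram_similar_scale n (G1 G2 : 'M[R]_n) (r : R) :
  0 < r -> G1 = r *: G2 -> Gram_similar G1 G2.
Proof.
move=> r0 ->; exists r, 1%:M; split; rewrite ?unitmx1 //.
by rewrite map_mx1 trmx1 mul1mx mulmx1.
Qed.

Definition bform_bilinear L : Prop :=
  (forall (k : R) (x y z : ambient L),
     bform (k *: x + y) z = k * bform x z + bform y z) /\
  (forall (k : R) (x y z : ambient L),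
     bform z (k *: x + y) = k * bform z x + bform z y).

Lemma bform_comb L n (e : 'I_n -> ambient L) (c d : 'rV[int]_n) :
  bform_bilinear L ->
  bform (\sum_i e i *~ c 0 i) (\sum_i e i *~ d 0 i) =
  (intmx c *m (\matrix_(i, j) bform (e i) (e j)) *m (intmx d)^T) 0 0.
Proof.
case=> linl linr.
have b0l (z : ambient L) : bform 0 z = 0.
  by have := linl (-1) 0 0 z; rewrite scaler0 addr0 mulN1r addNr.
have b0r (z : ambient L) : bform z 0 = 0.
  by have := linr (-1) 0 0 z; rewrite scaler0 addr0 mulN1r addNr.
have suml (z : ambient L) :
    bform (\sum_i e i *~ c 0 i) z = \sum_i (c 0 i)%:~R * bform (e i) z.
  elim/big_rec2: _ => [|i y s _ <-]; first exact: b0l.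
  by rewrite -scaler_int linl.
have sumr (z : ambient L) :
    bform z (\sum_i e i *~ d 0 i) = \sum_i (d 0 i)%:~R * bform z (e i).
  elim/big_rec2: _ => [|i y s _ <-]; first exact: b0r.
  by rewrite -scaler_int linr.
rewrite sumr mxE; apply: eq_bigr => j _.
rewrite suml !mxE mulrC; congr (_ * _).
by apply: eq_bigr => i _; rewrite !mxE.
Qed.

(** Absorbing [U] into the coordinates of [M] parametrizes both lattices by the same integer
    vectors, with forms differing by the factor [r]. Non-similarity then becomes a comparison of
    form values. *)
Lemma similar_coordinates L M : bform_bilinear L -> bform_bilinear M ->
  lattice_similar L M ->
  exists n (p : 'rV[int]_n -> ambient L) (q : 'rV[int]_n -> ambient M) (r : R),
  [/\ 0 < r, forall x : ambient L, carrier x <-> exists c, x = p c,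
      forall x : ambient M, carrier x <-> exists c, x = q c
    & forall c d, bform (p c) (p d) = r * bform (q c) (q d)].
Proof.
move=> bilL bilM [n [G1 [G2 [[e [eP _] G1E] [f [fP _] G2E]
  [r [U [r_gt0 Uunit GE]]]]]]].
exists n, (fun c : 'rV[int]_n => \sum_(i < n) e`_i *~ c 0 i),
  (fun c : 'rV[int]_n => \sum_(i < n) f`_i *~ (c *m U) 0 i), r; split=> //.
- move=> x; split=> [/eP [c ->] | [c ->]].
    by exists (\row_i c i); apply: eq_bigr => i _; rewrite mxE.
  by apply/eP; exists [ffun i => c 0 i]; apply: eq_bigr => i _; rewrite ffunE.
- move=> x; split=> [/fP [c ->] | [c ->]].
    exists ((\row_i c i) *m invmx U); apply: eq_bigr => i _.
    by rewrite mulmxKV // mxE.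
  apply/fP; exists [ffun i => (c *m U) 0 i].
  by apply: eq_bigr => i _; rewrite ffunE.
move=> c d.
rewrite (bform_comb (fun i : 'I_n => e`_i)) // -G1E.
rewrite (bform_comb (fun i : 'I_n => f`_i)) // -G2E GE.
rewrite -scalemxAr -scalemxAl mxE !map_mxM trmx_mul !mulmxA.
by [].
Qed.

Lemma Gram_lattice_bilinear n (G : 'M[R]_n) :
  bform_bilinear (Gram_lattice G).
Proof.
split=> k x y z /=.
  by rewrite !mulmxDl -!scalemxAl 2!mxE.
by rewrite linearD linearZ /= mulmxDr -scalemxAr 2!mxE.
Qed.

Lemma D4_bilinear : bform_bilinear (D4_lattice R).
Proof.
split=> k x y z /=.
  by rewrite !mulmxDl -!scalemxAl 2!mxE.
by rewrite linearD linearZ /= mulmxDr -scalemxAr 2!mxE.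
Qed.

Lemma A2A2_bilinear : bform_bilinear (A2A2_lattice R).
Proof.
have [linl linr] := Gram_lattice_bilinear
  (\matrix_(i < 2, j < 2) (if i == j then 2 else -1) : 'M[R]_2).
split=> k [x1 x2] [y1 y2] [z1 z2]; rewrite /= in linl linr *.
  by rewrite !linl mulrDr addrACA.
by rewrite !linr mulrDr addrACA.
Qed.

Lemma Z4_carrierP (x : 'rV[R]_4) : carrier (l := Z4_lattice R) x <->
  exists z0 z1 z2 z3 : int, x = intmx (irow4 z0 z1 z2 z3).
Proof.
split=> [[z ->] | [z0 [z1 [z2 [z3 ->]]]]]; last by eexists.
by exists (z 0 0), (z 0 1), (z 0 2), (z 0 3); rewrite -irow4P.
Qed.

Lemma A2A2_carrierP (x : 'rV[R]_2 * 'rV[R]_2) :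
  carrier (l := A2A2_lattice R) x <->
  exists z0 z1 z2 z3 : int,
    x = (intmx (irow2 z0 z1), intmx (irow2 z2 z3)).
Proof.
case: x => x y.
split=> [[[z /= ->] [w /= ->]] | [z0 [z1 [z2 [z3 [-> ->]]]]]].
  by exists (z 0 0), (z 0 1), (w 0 0), (w 0 1); rewrite -!irow2P.
by split; eexists.
Qed.

(** Integral values including 1 fix the scale of the lattice; evenness of the diagonal is what [Z^4]
    fails at any matching scale. *)
Definition even_primitive L : Prop :=
  [/\ forall x y : ambient L, carrier x -> carrier y ->
        exists k : int, bform x y = k%:~R,
      forall x : ambient L, carrier x -> exists k : int, bform x x = (k * 2)%:~R
    & exists x y : ambient L, [/\ carrier x, carrier y & bform x y = 1]].

Lemma D4_even : even_primitive (D4_lattice R).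
Proof.
split.
- move=> x y /D4_carrierP [x0 [x1 [x2 [x3 [k [_ ->]]]]]].
  move=> /D4_carrierP [y0 [y1 [y2 [y3 [l [_ ->]]]]]].
  by rewrite /= dot_irow4; eexists.
- move=> x /D4_carrierP [x0 [x1 [x2 [x3 [k [xE ->]]]]]].
  (* Writing [z^2 = z (z - 1) + z] splits the norm into even terms and the coordinate sum, which is
     even in [D_4]. *)
  have [x0E x1E] : (x0 * x0 = x0 * (x0 - 1) + x0) /\ x1 * x1 = x1 * (x1 - 1) + x1.
    by split; ring.
  have [x2E x3E] : (x2 * x2 = x2 * (x2 - 1) + x2) /\ x3 * x3 = x3 * (x3 - 1) + x3.
    by split; ring.
  have even (z : int) : exists l, z * (z - 1) = l * 2.
    have [m [->|->]] : exists m, z = m * 2 \/ z = m * 2 + 1.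
      by exists (z %/ 2)%Z; lia.
      by exists (m * (m * 2 - 1)); ring.
    by exists (m * (m * 2 + 1)); ring.
  have [l0 l0E] := even x0; have [l1 l1E] := even x1.
  have [l2 l2E] := even x2; have [l3 l3E] := even x3.
  rewrite /= dot_irow4 x0E x1E x2E x3E l0E l1E l2E l3E.
  by exists (l0 + l1 + l2 + l3 + k); congr (_%:~R); lia.
- exists (intmx (irow4 1 1 0 0)), (intmx (irow4 1 0 1 0)); split.
  + by apply/D4_carrierP; exists 1, 1, 0, 0, 1.
  + by apply/D4_carrierP; exists 1, 0, 1, 0, 1.
  + by rewrite /= dot_irow4.
Qed.

Lemma A2A2_even : even_primitive (A2A2_lattice R).
Proof.
split.
- move=> x y /A2A2_carrierP [x0 [x1 [x2 [x3 ->]]]].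
  move=> /A2A2_carrierP [y0 [y1 [y2 [y3 ->]]]].
  by rewrite A2A2_bformE; eexists.
- move=> x /A2A2_carrierP [x0 [x1 [x2 [x3 ->]]]]; rewrite A2A2_bformE.
  exists (x0 * x0 - x0 * x1 + x1 * x1 + (x2 * x2 - x2 * x3 + x3 * x3)).
  by congr (_%:~R); ring.
- exists (intmx (irow2 1 0), intmx (irow2 0 0)).
  exists (intmx (irow2 0 (-1)), intmx (irow2 0 0)); split.
  + by apply/A2A2_carrierP; do 4!eexists.
  + by apply/A2A2_carrierP; do 4!eexists.
  + by rewrite A2A2_bformE.
Qed.

(** A pair of value 1 in [M] shows that the factor [r] is an integer; a unit vector of [Z^4] then
    has norm [r] times an even integer, yet its norm is 1. *)
Lemma Z4_not_similar_even M : bform_bilinear M -> even_primitive M ->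
  ~ lattice_similar (Z4_lattice R) M.
Proof.
move=> bilM [_ evenM [x [y [Mx My xy1]]]].
move=> /(similar_coordinates (Gram_lattice_bilinear _) bilM).
case=> n [p [q [r [r_gt0 pP qP pqE]]]].
have [c xE] := (qP x).1 Mx; have [d yE] := (qP y).1 My.
have [c' zE] : exists c', intmx (irow4 1 0 0 0) = p c'.
  by apply/pP/Z4_carrierP; do 4!eexists.
have := pqE c d; rewrite -xE -yE xy1 mulr1 => rE.
have [x0 [x1 [x2 [x3 pc]]]] : exists z0 z1 z2 z3, p c = intmx (irow4 z0 z1 z2 z3).
  by apply/Z4_carrierP/pP; exists c.
have [y0 [y1 [y2 [y3 pd]]]] : exists z0 z1 z2 z3, p d = intmx (irow4 z0 z1 z2 z3).
  by apply/Z4_carrierP/pP; exists d.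
have [k kE] : exists k : int, bform (q c') (q c') = (k * 2)%:~R.
  by apply/evenM/qP; exists c'.
move: rE; rewrite pc pd Z4_bformE => rE.
have := pqE c' c'; rewrite -zE Z4_bformE kE -rE -intrM => /intr_inj.
lia.
Qed.

(** The vector [(2, 0, 0, 0)] of [D_4] has norm 4 and pairs evenly with the lattice. In [A_2 + A_2]
    such a vector is twice a lattice vector, as the Gram determinant is odd, so its norm is
    divisible by 8. *)
Lemma D4_not_similar_A2A2 :
  ~ lattice_similar (D4_lattice R) (A2A2_lattice R).
Proof.
have [intD _ [x [y [Dx Dy xy1]]]] := D4_even.
have [intA _ [x' [y' [Ax' Ay' xy1']]]] := A2A2_even.
move=> /(similar_coordinates D4_bilinear A2A2_bilinear).
case=> n [p [q [r [r_gt0 pP qP pqE]]]].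
have Dp c : carrier (l := D4_lattice R) (p c) by apply/pP; exists c.
have Aq c : carrier (l := A2A2_lattice R) (q c) by apply/qP; exists c.
(* Pairs of value 1 on either side make both [r] and its inverse integers. *)
have r1 : r = 1.
  have [c xE] := (pP x).1 Dx; have [d yE] := (pP y).1 Dy.
  have [c' xE'] := (qP x').1 Ax'; have [d' yE'] := (qP y').1 Ay'.
  have := pqE c' d'; rewrite -xE' -yE' xy1' mulr1.
  have [k ->] := intD _ _ (Dp c') (Dp d') => rE.
  have := pqE c d; rewrite -xE -yE xy1 -rE.
  have [l ->] := intA _ _ (Aq c) (Aq d).
  rewrite -intrM => /(@intr_inj R 1) kl.
  have k_gt0 : 0 < k by rewrite -(ltr0z R) rE.
  have l_gt0 : 0 < l by rewrite -(pmulr_rgt0 _ k_gt0) -kl.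
  by have -> : k = 1 by nia.
have [c wE] : exists c, intmx (irow4 2 0 0 0) = p c.
  by apply/pP/D4_carrierP; exists 2, 0, 0, 0, 1.
have [x0 [x1 [x2 [x3 qcE]]]] := (A2A2_carrierP (q c)).1 (Aq c).
have even z0 z1 z2 z3 : exists k : int,
    bform (q c) ((intmx (irow2 z0 z1), intmx (irow2 z2 z3)) : ambient (A2A2_lattice R))
    = (k * 2)%:~R.
  have [d ->] : exists d, (intmx (irow2 z0 z1), intmx (irow2 z2 z3)) = q d.
    by apply/qP/A2A2_carrierP; do 4!eexists.
  have := pqE c d; rewrite r1 mul1r => <-; rewrite -wE.
  have [y0 [y1 [y2 [y3 [k [_ ->]]]]]] := (D4_carrierP (p d)).1 (Dp d).
  by rewrite /= dot_irow4; exists y0; congr (_%:~R); lia.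
have [k0] := even 1 0 0 0; have [k1] := even 0 1 0 0.
have [k2] := even 0 0 1 0; have [k3] := even 0 0 0 1.
have := pqE c c; rewrite r1 mul1r -wE qcE !A2A2_bformE /= dot_irow4.
move=> /intr_inj E /intr_inj E3 /intr_inj E2 /intr_inj E1 /intr_inj E0.
(* Even pairing with a basis vector of [A_2] makes [2 x1 - x0] even, hence [x0]; the other
   coordinates follow in the same way. *)
have [m0 m0E] : exists m, x0 = m * 2 by exists (k1 * -1 + x1); lia.
have [m1 m1E] : exists m, x1 = m * 2 by exists (k0 * -1 + x0); lia.
have [m2 m2E] : exists m, x2 = m * 2 by exists (k3 * -1 + x3); lia.
have [m3 m3E] : exists m, x3 = m * 2 by exists (k2 * -1 + x2); lia.
move: E; rewrite m0E m1E m2E m3E => E.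
lia.
Qed.

End Similarity.

(** * Classification and realization *)

Section Main.
Variables (R : realType) (alpha : rat).
Hypothesis alpha_gt0 : 0 < alpha.

(** In the applications [c] is [alpha], and [r] compares [quadgram] with the Gram matrix of the
    target: 2 for [Z^4], 1 for the other two. *)
Lemma lattice_similar_Gram (M N : lattice R) (G : 'M[R]_4) (c r : R) :
  0 < c -> 0 < r -> is_Gram M (c *: (r *: G)) -> is_Gram N G ->
  lattice_similar M N.
Proof.
move=> c0 r0 MG NG; exists 4%N, (c *: (r *: G)), G; split=> //.
by apply: (@Gram_similar_scale _ _ _ _ (c * r)); rewrite ?mulr_gt0 ?scalerA.
Qed.

Lemma quadgram_Z4 : quadgram 0 0 0 = 2 *: 1%:M :> 'M[R]_4.
Proof.
by apply/matrixP => -[[|[|[|[|//]]]] lti] [[|[|[|[|//]]]] ltj];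
  rewrite !mxE /= ?mulr1 ?mulr0 ?subr0.
Qed.

Definition special_target (tau s t : rat) (M : lattice R) : Prop :=
  [\/ [/\ tau = 0, s = 0, t = 0 & M = Z4_lattice R],
      [/\ tau = 1, s = 1, t = 0 & M = D4_lattice R]
    | [/\ tau = 1, s = 0, t = 0 & M = A2A2_lattice R]].

Lemma special_target_similar (tau s t : rat) (M N : lattice R) :
  special_target tau s t N ->
  is_Gram M (ratr alpha *: quadgram (ratr tau) (ratr s) (ratr t)) ->
  lattice_similar M N.
Proof.
have a_gt0 : 0 < ratr alpha :> R by rewrite ltr0q.
case=> -[-> -> -> ->]; rewrite ?rmorph0 ?rmorph1.
- rewrite quadgram_Z4 => MG.
  exact: lattice_similar_Gram a_gt0 _ MG (Z4_Gram R).
- rewrite -[quadgram _ _ _]scale1r => MG.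
  exact: lattice_similar_Gram a_gt0 ltr01 MG (D4_Gram R).
- rewrite -[quadgram _ _ _]scale1r => MG.
  exact: lattice_similar_Gram a_gt0 ltr01 MG (A2A2_Gram R).
Qed.

Lemma well_rounded_order_similar (a b : rat) (L : {pred quat a b}) :
  a != 0 -> b != 0 -> totally_definite R a b -> is_order L ->
  well_rounded (order_lattice R alpha L) ->
  exists2 M, lattice_similar (order_lattice R alpha L) M &
    [\/ M = Z4_lattice R, M = D4_lattice R | M = A2A2_lattice R].
Proof.
move=> a0 b0 /(totally_definite_lt0 a0 b0) [a_lt0 b_lt0] Lo wr.
have Lring : subring_closed L by case: Lo.
have Lnrd := order_qnrd_int Lo.
have outside := well_rounded_unit_outside a_lt0 b_lt0 alpha_gt0 Lring Lnrd wr.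
have [u [v [Nu Nv hp no1]]] :=
  exists_special_generators a_lt0 b_lt0 Lring Lnrd outside.
have gen := quadbasis_generates a_lt0 b_lt0 Lring Lnrd Nu Nv hp no1.
have MG := order_lattice_Gram R alpha a_lt0 b_lt0 Lring Nu Nv hp gen.
case: hp => -[tau s t]; [exists (Z4_lattice R) | exists (A2A2_lattice R)
  | exists (D4_lattice R)]; try by [apply: Or31 | apply: Or32 | apply: Or33].
- by apply: special_target_similar MG; apply: Or31.
- by apply: special_target_similar MG; apply: Or33.
- by apply: special_target_similar MG; apply: Or32.
Qed.

Lemma special_target_occurs (a b : rat) (u v : quat a b) (M : lattice R) :
  a < 0 -> b < 0 -> qnrd u = 1 -> qnrd v = 1 ->
  special_target (qtr u) (qtr v) (qpair u v) M ->
  exists (a b : rat) (L : {pred quat a b}),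
    [/\ a != 0 /\ b != 0, totally_definite R a b, is_order L,
        well_rounded (order_lattice R alpha L)
      & lattice_similar (order_lattice R alpha L) M].
Proof.
move=> a_lt0 b_lt0 nu nv tgt.
have hp : special_params (qtr u) (qtr v) (qpair u v).
  by case: tgt => -[? ? ? _]; [apply: Or31 | apply: Or33 | apply: Or32].
exists a, b, (span_order u v).
have Lo := span_order_is_order a_lt0 b_lt0 nu nv hp.
have Lring : subring_closed (span_order u v) by case: Lo.
have [_ [Nu Nv]] := span_order_norm1 a_lt0 b_lt0 nu nv hp.
split=> //; first by rewrite !lt_eqF.
- exact: totally_definite_neg.
- exact: (well_rounded_quadbasis a_lt0 b_lt0 alpha_gt0 Lring
    (order_qnrd_int Lo) Nu Nv hp).
apply: (special_target_similar tgt).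
apply: (order_lattice_Gram R alpha a_lt0 b_lt0 Lring Nu Nv hp) => x.
by move/(span_orderP a_lt0 b_lt0 nu nv hp).
Qed.

Local Ltac qcompute :=
  rewrite /qpair /qtr /qnrd ?qmulE /qmul /qconj ?(qcoef_mk, qcoefD) /=; lra.

Lemma targets_occur (M : lattice R) :
  [\/ M = Z4_lattice R, M = D4_lattice R | M = A2A2_lattice R] ->
  exists (a b : rat) (L : {pred quat a b}),
    [/\ a != 0 /\ b != 0, totally_definite R a b, is_order L,
        well_rounded (order_lattice R alpha L)
      & lattice_similar (order_lattice R alpha L) M].
Proof.
case=> ->.
(* The Lipschitz order, with [u = i] and [v = j]. *)
- apply: (@special_target_occurs (-1) (-1) (mkquat _ _ 0 1 0 0)
    (mkquat _ _ 0 0 1 0)) => //; try qcompute.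
  by apply: Or31; split=> //; qcompute.
(* The Hurwitz order, with [u = (1 + i + j + ij) / 2] and [v = (1 + i - j - ij) / 2]. *)
- apply: (@special_target_occurs (-1) (-1) (mkquat _ _ (1/2) (1/2) (1/2) (1/2))
    (mkquat _ _ (1/2) (1/2) (- (1/2)) (- (1/2)))) => //; try qcompute.
  by apply: Or32; split=> //; qcompute.
(* With [i^2 = -3], [u = (1 + i) / 2] is a sixth root of unity and [v = j]; the order is [E + E j]
   for the Eisenstein integers [E]. *)
- apply: (@special_target_occurs (-3) (-1) (mkquat _ _ (1/2) (1/2) 0 0)
    (mkquat _ _ 0 0 1 0)) => //; try qcompute.
  by apply: Or33; split=> //; qcompute.
Qed.

End Main.

Theorem theorem3p3p3 (R : realType) (alpha : rat) (alpha_gt0 : 0 < alpha) :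
  [/\ forall (a b : rat) (L : {pred quat a b}),
        a != 0 -> b != 0 -> totally_definite R a b -> is_order L ->
        well_rounded (order_lattice R alpha L) ->
        [\/ lattice_similar (order_lattice R alpha L) (Z4_lattice R),
            lattice_similar (order_lattice R alpha L) (D4_lattice R)
          | lattice_similar (order_lattice R alpha L) (A2A2_lattice R)],
      forall M : lattice R,
        [\/ M = Z4_lattice R, M = D4_lattice R | M = A2A2_lattice R] ->
        exists (a b : rat) (L : {pred quat a b}),
          [/\ a != 0 /\ b != 0, totally_definite R a b, is_order L,
              well_rounded (order_lattice R alpha L)
            & lattice_similar (order_lattice R alpha L) M]
    & [/\ ~ lattice_similar (Z4_lattice R) (D4_lattice R),
          ~ lattice_similar (Z4_lattice R) (A2A2_lattice R)
        & ~ lattice_similar (D4_lattice R) (A2A2_lattice R)]].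
Proof.
split; last split.
- move=> a b L a0 b0 td Lo wr.
  have [M simM tgt] := well_rounded_order_similar alpha_gt0 a0 b0 td Lo wr.
  by case: tgt simM => ->; [apply: Or31 | apply: Or32 | apply: Or33].
- by move=> M; apply: targets_occur.
- exact: Z4_not_similar_even (@D4_bilinear R) (@D4_even R).
- exact: Z4_not_similar_even (@A2A2_bilinear R) (@A2A2_even R).
- exact: D4_not_similar_A2A2.
Qed.
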